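(* Let $n\ge 1$ and let $\mathcal{G}$ be an abelian sub-semigroup (under composition) of $MA(n,\mathbb{C})$. Let $G=\Phi(\mathcal{G})$, let $r\le n+1$, $\eta=(n_1,\dots,n_r)$ and $P\in\Phi(GA(n,\mathbb{C}))$ be such that $P^{-1}GP\subset \mathcal{K}_{\eta,r}(\mathbb{C})\cap\Phi(MA(n,\mathbb{C}))$, and let $w_0\in\mathbb{C}^n$ and $\mathfrak{q}_{w_0}\subset\mathbb{C}^n$ be the vector and the set associated with $\mathcal{G}$ and $P$ as defined in the context. Then the following are equivalent: (i) $\mathcal{G}$ is hypercyclic; (ii) the orbit $\mathcal{G}(w_0)$ is dense in $\mathbb{C}^n$; (iii) $\mathfrak{q}_{w_0}$ is an additive sub-semigroup dense in $\mathbb{C}^n$.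
   Context: $MA(n,\mathbb{C})$ is the set of affine maps $f=(A,a):\mathbb{C}^n\to\mathbb{C}^n$, $f(x)=Ax+a$, with $A\in M_n(\mathbb{C})$, $a\in\mathbb{C}^n$; it is a vector space under pointwise operations and a semigroup under composition. $GA(n,\mathbb{C})$ is the group of invertible elements of $MA(n,\mathbb{C})$. For $v\in\mathbb{C}^n$, $\mathcal{G}(v)=\{f(v): f\in\mathcal{G}\}$; $\mathcal{G}$ is hypercyclic if $\overline{\mathcal{G}(v)}=\mathbb{C}^n$ for some $v\in\mathbb{C}^n$. Define $\Phi,\Psi:MA(n,\mathbb{C})\to M_{n+1}(\mathbb{C})$ by $\Phi(A,a)=\begin{bmatrix}1&0\\ a&A\end{bmatrix}$ and $\Psi(A,a)=\begin{bmatrix}0&0\\ a&A\end{bmatrix}$. Put $G=\Phi(\mathcal{G})$. $\mathbb{T}_m(\mathbb{C})$ is the set of $m\times m$ lower triangular complex matrices all of whose diagonal entries are equal to one another. For positive integers $n_1,\dots,n_r$ with $n_1+\dots+n_r=n+1$ and $\eta=(n_1,\dots,n_r)$, $\mathcal{K}_{\eta,r}(\mathbb{C})=\mathbb{T}_{n_1}(\mathbb{C})\oplus\dots\oplus\mathbb{T}_{n_r}(\mathbb{C})$ (block diagonal matrices). Put $u_0=(e_{1,1},\dots,e_{r,1})\in\mathbb{C}^{n+1}$ with $e_{k,1}=(1,0,\dots,0)\in\mathbb{C}^{n_k}$, and $v_0=Pu_0$; then $v_0\in\{1\}\times\mathbb{C}^n$ and $w_0$ is defined by $v_0=(1,w_0)$.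 With $\exp$ the matrix exponential, $\mathrm{g}=\exp^{-1}(G)\cap P\mathcal{K}_{\eta,r}(\mathbb{C})P^{-1}$, $\mathrm{g}^1=\mathrm{g}\cap\Psi(MA(n,\mathbb{C}))$, $\mathfrak{q}=\Psi^{-1}(\mathrm{g}^1)\subset MA(n,\mathbb{C})$, and $\mathfrak{q}_{v}=\{f(v): f\in\mathfrak{q}\}$ for $v\in\mathbb{C}^n$. *)

(* Defs.v *)
From HB Require Import structures.
From mathcomp Require Import all_boot all_order all_algebra.
From mathcomp Require Import complex.
From mathcomp Require Import all_classical all_reals all_analysis.

Set Implicit Arguments.
Unset Strict Implicit.
Unset Printing Implicit Defensive.

Import Order.TTheory GRing.Theory Num.Theory numFieldNormedType.Exports.

Local Open Scope classical_set_scope.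
Local Open Scope ring_scope.
Local Open Scope complex_scope.

(* The library equips numFieldTypes, but not the type R[i] itself, with the    *)
(* topology of the modulus. Matrices over R[i] then carry the entrywise        *)
(* topology of the library, i.e. the usual topology of C^(m * n).              *)
HB.instance Definition _ (R : rcfType) := NormedModule.copy R[i] R[i]^o.

Section AffineMaps.
Variables (R : realType) (n : nat).

(* MA(n, C), the pair (A, a) standing for the map x |-> A x + a. *)
Definition affmap : Type := ('M[R[i]]_n * 'cV[R[i]]_n)%type.

Definition aff_app (f : affmap) (x : 'cV[R[i]]_n) : 'cV[R[i]]_n :=
  f.1 *m x + f.2.

Definition aff_comp (f g : affmap) : affmap :=
  (f.1 *m g.1, f.1 *m g.2 + f.2).

Definition aff_id : affmap := (1%:M, 0).

Lemma aff_compE f g x : aff_app (aff_comp f g) x = aff_app f (aff_app g x).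
Proof. by rewrite /aff_app /= mulmxDr mulmxA addrA. Qed.

Lemma aff_idE x : aff_app aff_id x = x.
Proof. by rewrite /aff_app /= mul1mx addr0. Qed.

(* A pair is determined by the map it stands for. *)
Lemma aff_app_inj f g : aff_app f =1 aff_app g -> f = g.
Proof.
case: f g => [A a] [B b]; rewrite /aff_app /= => fg.
have ab : a = b by have := fg 0; rewrite !mulmx0 !add0r.
move: fg; rewrite {}ab => fg; congr (_, _).
apply/matrixP => i j; have /addIr := fg (delta_mx j 0).
by rewrite -!colE => /matrixP/(_ i 0); rewrite !mxE.
Qed.

Definition GA : set affmap :=
  [set f | exists g, aff_comp f g = aff_id /\ aff_comp g f = aff_id].

Definition abelian_subsemigroup (G : set affmap) : Prop :=
  (forall f g, G f -> G g -> G (aff_comp f g)) /\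
  (forall f g, G f -> G g -> aff_comp f g = aff_comp g f).

Definition aff_orbit (F : set affmap) (v : 'cV[R[i]]_n) : set 'cV[R[i]]_n :=
  [set aff_app f v | f in F].

Definition hypercyclic (G : set affmap) : Prop :=
  exists v, closure (aff_orbit G v) = [set: 'cV[R[i]]_n].

Definition Phi (f : affmap) : 'M[R[i]]_(1 + n) := block_mx 1%:M 0 f.2 f.1.

Definition Psi (f : affmap) : 'M[R[i]]_(1 + n) := block_mx 0 0 f.2 f.1.

End AffineMaps.

Definition additive_subsemigroup (V : zmodType) (S : set V) : Prop :=
  forall x y, S x -> S y -> S (x + y).

(* The entrywise limit of the partial sums of \sum_k A^k / k!. *)
Definition expmx (R : realType) (m : nat) (A : 'M[R[i]]_m) : 'M[R[i]]_m :=
  limn (series (fun k => (k`!%:R)^-1 *: A ^+ k)).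

(* is_trig_mx is lower triangularity. *)
Definition TT (R : realType) (m : nat) : set 'M[R[i]]_m :=
  [set A | is_trig_mx A /\ forall i j, A i i = A j j].

Section Blocks.
(* The partition eta = (n_1, ..., n_r) of m; the equation eta_sum only serves  *)
(* to see matrices of size \sum_k eta k as matrices of size m.                 *)
Variables (R : realType) (r : nat) (eta : 'I_r -> nat) (m : nat).
Variable eta_sum : (\sum_k eta k)%N = m.

Definition KK : set 'M[R[i]]_m :=
  [set M | exists B : forall k, 'M[R[i]]_(eta k),
     (forall k, TT (B k)) /\ M = castmx (eta_sum, eta_sum) (\mxdiag_k B k)].

Definition u0 : 'cV[R[i]]_m :=
  castmx (eta_sum, erefl 1%N)
    (\mxcol_(k < r) \col_(j < eta k) ((j == 0 :> nat)%:R : R[i])).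

End Blocks.

Section Exponents.
Variables (R : realType) (n r : nat) (eta : 'I_r -> nat).
Variable eta_sum : (\sum_k eta k)%N = (1 + n)%N.
Variable P : 'M[R[i]]_(1 + n).

(* v_0 = P u_0 without its first coordinate, which is 1: see w0P. *)
Definition w0 : 'cV[R[i]]_n := dsubmx (P *m u0 R eta_sum).

Lemma w0P : [set Phi f | f in @GA R n] P ->
  P *m u0 R eta_sum = col_mx 1%:M w0.
Proof.
move=> [f _ defP]; rewrite -[LHS]vsubmxK; congr col_mx.
rewrite -defP -[u0 _ _]vsubmxK mul_block_col mul1mx mul0mx addr0 !col_mxKu.
apply/matrixP => i j; rewrite !ord1 !mxE castmxE /= !mxE.
set s := cast_ord _ _.
have : (s : nat) = 0%N by [].
rewrite tagnat.rect => /eqP.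
by rewrite addn_eq0 => /andP[_ ->].
Qed.

Variable G : set (affmap R n).

Definition gg : set 'M[R[i]]_(1 + n) :=
  [set M | [set Phi f | f in G] (expmx M)] `&`
  [set P *m K *m invmx P | K in KK eta_sum].

Definition gg1 : set 'M[R[i]]_(1 + n) := gg `&` range (@Psi R n).

Definition qq : set (affmap R n) := @Psi R n @^-1` gg1.

End Exponents.

(* Main.v *)
Require Import Defs.
From mathcomp Require Import all_boot all_order all_algebra.
From mathcomp Require Import ring complex.
From mathcomp Require Import all_classical all_reals all_analysis.
Import Order.TTheory GRing.Theory Num.Theory numFieldNormedType.Exports.

(** The map Phi turns affine maps of C^n into matrices acting on C^(1 + n) and
    preserving the slice of vectors with first coordinate 1; conjugating by P,
    the semigroup becomes a set H of commuting matrices which are block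
    diagonal, lower triangular, and constant on the diagonal of each block.
    The point w0 becomes the vector u with a 1 at the head of each block and 0
    elsewhere, and q becomes the set L of the block triangular N with top row 0
    and exp N in H (log_set). One has to compare the density in a slice of the
    orbits H v, H u and L u.

    For a commuting set S of such matrices, let A be the bicommutant of S among
    them (bicomm). It is a commutative algebra, and it contains the exponentials
    of its elements and the logarithms of its invertible ones. Subspaces of a
    finite-dimensional space being closed (linear_set_closed), a dense S-orbit
    of v forces A v to be the whole space, and then commutativity makes
    X |-> X v a linear isomorphism from A onto C^(1 + n), with a continuous
    inverse theta (bicomm_section).

    (i) => (ii): pick X in A with X v = u. Its diagonal entries at the heads of
    the blocks are nonzero, so X is invertible, and H u = X (H v) is dense
    (dense_orbit_head).

    (ii) => (iii): the exponential of A is locally invertible. Given N in A with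
    N u = w, elements h of H with h u close to exp(N) u are close to exp N, so
    N + log(exp(-N) h) belongs to L and is close to N (dense_log_set).

    (iii) => (i): L commutes, because the exponentials of its elements do and
    each block of N is, up to a scalar, a polynomial in the corresponding block
    of exp N (comm_of_block_exp). So the bicommutant of L can be used: a vector
    w of the slice whose head coordinates are nonzero is X u for an invertible
    X, the vector log(X) u is a limit of points N u with N in L, and applying
    exp o theta shows that w is a limit of points of H u
    (dense_orbit_of_log_set). Vectors with nonzero head coordinates are dense in
    the slice. Commutativity of L also shows that L is closed under addition.

    On a block triangular matrix D + N, with D diagonal and N nilpotent, the
    exponential is exp(D) times a truncated exponential of N. This reduces the
    matrix exponential to the complex exponential, which is summed by comparing
    the product of the partial sums at x and i y with the partial sum at x + i y
    (exp_sum_cvg), and the matrix logarithm to a complex logarithm on D and to a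
    polynomial inverse, modulo X^m, of the truncated exponential
    (nilpotent_log). *)

Set Implicit Arguments.
Unset Strict Implicit.
Unset Printing Implicit Defensive.

Local Open Scope classical_set_scope.
Local Open Scope ring_scope.
Local Open Scope complex_scope.

Local Notation Re := (@complex.Re _).
Local Notation Im := (@complex.Im _).

(** * Truncated exponentials *)

Definition trunc_exp (F : numFieldType) (A : algType F) (K : nat) (a : A) : A :=
  \sum_(k < K) (k`!%:R : F)^-1 *: a ^+ k.

Lemma sum_triangle (V : zmodType) (f : nat -> nat -> V) K :
  \sum_(k < K) \sum_(i < k.+1) f i (k - i)%N =
  \sum_(i < K) \sum_(j < K - i) f i j.
Proof.
elim: K => [|K IH]; first by rewrite !big_ord0.
rewrite big_ord_recr/= IH.
under [RHS]eq_bigr => i _ do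
  rewrite subSn -1?ltnS// big_ord_recr/=.
rewrite big_split/=; congr (_ + _).
by rewrite big_ord_recr/= subnn big_ord0 addr0.
Qed.

(** The binomial formula, divided by k!, is a Cauchy product: the terms of degree
    less than K of the product of two truncated exponentials. *)
Lemma trunc_expD_triangle (F : numFieldType) (A : algType F) K (a b : A) :
  a * b = b * a ->
  trunc_exp K (a + b) = \sum_(i < K) \sum_(j < K - i)
     ((i`!%:R : F)^-1 *: a ^+ i) * ((j`!%:R : F)^-1 *: b ^+ j).
Proof.
move=> ab.
rewrite -(sum_triangle (fun i j =>
  ((i`!%:R : F)^-1 *: a ^+ i) * ((j`!%:R : F)^-1 *: b ^+ j))).
apply: eq_bigr => k _.
rewrite addrC (exprDn_comm _ (esym ab)) scaler_sumr; apply: eq_bigr => i _.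
have ik : (i <= k)%N by rewrite -ltnS.
rewrite -scalerAl -scalerAr scalerA.
rewrite (commrX _ (commr_sym (commrX (k - i) ab))).
rewrite -scalerMnr scalerMnl -mulr_natr; congr (_ *: _).
have f0 j : (j`!%:R : F) != 0 by rewrite pnatr_eq0 -lt0n fact_gt0.
rewrite -(bin_fact ik) !natrM; field.
by rewrite !f0 -[_ != 0]/('C(k, i)%:R != 0) pnatr_eq0 -lt0n bin_gt0 ik.
Qed.

(** The product of truncated exponentials differs from the truncation at a + b by
    the terms of total degree at least K. In this form the error can be bounded,
    and it vanishes on nilpotent elements. *)
Lemma trunc_expM (F : numFieldType) (A : algType F) K (a b : A) :
  a * b = b * a ->
  trunc_exp K a * trunc_exp K b = trunc_exp K (a + b) + \sum_(i < K)
    \sum_(K - i <= j < K)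
     ((i`!%:R : F)^-1 *: a ^+ i) * ((j`!%:R : F)^-1 *: b ^+ j).
Proof.
move=> ab; rewrite trunc_expD_triangle// mulr_suml -big_split/=.
apply: eq_bigr => i _; rewrite mulr_sumr.
rewrite -(big_mkord xpredT (fun j =>
  ((i`!%:R : F)^-1 *: a ^+ i) * ((j`!%:R : F)^-1 *: b ^+ j))).
rewrite (@big_cat_nat _ _ _ (K - i)%N)//= ?leq_subr//.
by rewrite big_mkord.
Qed.

(** The case of scalars of [trunc_exp], kept apart because the regular module F^o
    would otherwise appear in every statement. *)
Definition exp_sum (F : numFieldType) (K : nat) (a : F) : F :=
  \sum_(k < K) (k`!%:R)^-1 * a ^+ k.

Lemma exp_sumM (F : numFieldType) K (a b : F) :
  exp_sum K a * exp_sum K b = exp_sum K (a + b) + \sum_(i < K)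
    \sum_(K - i <= j < K)
     (i`!%:R^-1 * a ^+ i) * (j`!%:R^-1 * b ^+ j).
Proof. exact: (@trunc_expM F F^o K a b (mulrC a b)). Qed.

(** Both sides are the same sum of terms of total degree at least K, on the right
    for the absolute values of a and b; so convergence of the real exponential,
    and its functional equation, control the complex error. *)
Lemma exp_sum_norm_le (F : numFieldType) K (a b : F) :
  `|exp_sum K a * exp_sum K b - exp_sum K (a + b)| <=
  exp_sum K `|a| * exp_sum K `|b| - exp_sum K (`|a| + `|b|).
Proof.
rewrite !exp_sumM [X in `|X|]addrAC subrr add0r.
rewrite [leRHS]addrAC subrr add0r.
apply: le_trans (ler_norm_sum _ _ _) _; apply: ler_sum => i _.
apply: le_trans (ler_norm_sum _ _ _) _; apply: ler_sum => j _.
by rewrite !normrM !normfV !normr_nat !normrX.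
Qed.

(** * Convergence of complex numbers *)

Section ComplexConvergence.
Variable R : realType.
Local Notation C := R[i].

Lemma continuous_real_complex : continuous (fun x : R => x%:C).
Proof.
move=> x; apply/cvgrPdist_lt => e e0.
move: (e0); rewrite ltcE /= => /andP[/eqP ie re].
near=> y; rewrite -rmorphB normc_def/= expr0n addr0 sqrtr_sqr.
rewrite [e]complexE ie mulr0 addr0 ltcR.
near: y; exact: (@cvgr_dist_lt _ _ _ _ _ id x).
Unshelve. all: by end_near. Qed.

Lemma Re_continuous : continuous (@complex.Re R).
Proof.
move=> x; have FF : Filter (nbhs (x : C)) := nbhs_filter x.
apply/cvgrPdist_lt => e e0.
have e0' : 0 < e%:C by rewrite ltcR.
near=> y; rewrite -ltcR; apply: le_lt_trans (_ : `|x - y| < _); last first.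
  near: y; apply: (@cvgr_dist_lt _ _ _ (nbhs x) _ id x) => //.
apply: le_trans (normc_ge_Re _); rewrite lecR.
by case: (x) (y) => [a b] [c d].
Unshelve. all: by end_near. Qed.

Lemma Im_continuous : continuous (@complex.Im R).
Proof.
have -> : (@complex.Im R) = (fun x => - Re (x * 'i%C)).
  by apply/funext => x; rewrite ReiNIm opprK.
move=> x; have FF : Filter (nbhs (x : C)) := nbhs_filter x.
apply: cvgN.
have c : (fun y : C => y * 'i%C) @ x --> x * 'i%C.
  by apply: (@cvgM _ C _ FF idfun (fun=> 'i%C));
    [exact: cvg_id | exact: cvg_cst].
exact: (cvg_comp _ _ c (@Re_continuous _)).
Qed.

Lemma cvg_complex (T : Type) (F : set_system T) (FF : Filter F) (f g : T -> R)
  a b :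
  f @ F --> a -> g @ F --> b -> (fun t => f t +i* g t) @ F --> a +i* b.
Proof.
move=> fa gb.
have E x y : x +i* y = x%:C + 'i%C * y%:C :> C by rewrite [LHS]complexE.
under eq_fun do rewrite E.
rewrite E; apply: cvgD; last apply: cvgM; first last.
- exact: (cvg_comp _ _ gb (@continuous_real_complex b)).
- exact: cvg_cst.
- exact: (cvg_comp _ _ fa (@continuous_real_complex a)).
Qed.

End ComplexConvergence.

(** * The complex exponential *)

Section ComplexExponential.
Variable R : realType.
Local Notation C := R[i].
Implicit Types z w : C.

Definition cexp z : C :=
  (expR (Re z) * cos (Im z)) +i* (expR (Re z) * sin (Im z)).

Lemma cexp0 : cexp 0 = 1.
Proof. by rewrite /cexp/= expR0 cos0 sin0 !mul1r. Qed.

Lemma cexpD z w : cexp (z + w) = cexp z * cexp w.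
Proof.
case: z w => [a b] [c d]; rewrite /cexp/= expRD cosD sinD.
by simpc; congr (_ +i* _); ring.
Qed.

Lemma cexp_neq0 z : cexp z != 0.
Proof.
apply/eqP => e0; have := cexpD z (- z).
by rewrite subrr cexp0 e0 mul0r => /eqP; rewrite oner_eq0.
Qed.

Lemma cexp_continuous : continuous cexp.
Proof.
move=> z; have FF : Filter (nbhs (z : C)) := nbhs_filter z.
apply: cvg_complex; apply: cvgM.
- exact: (cvg_comp _ _ (@Re_continuous R z) (@continuous_expR R _)).
- exact: (cvg_comp _ _ (@Im_continuous R z) (@continuous_cos R _)).
- exact: (cvg_comp _ _ (@Re_continuous R z) (@continuous_expR R _)).
- exact: (cvg_comp _ _ (@Im_continuous R z) (@continuous_sin R _)).
Qed.

Lemma exp_sum_real K (x : R) : exp_sum K (x%:C) = (exp_sum K x)%:C.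
Proof.
rewrite /exp_sum rmorph_sum; apply: eq_bigr => i _.
by rewrite rmorphM rmorphXn fmorphV rmorph_nat.
Qed.

Lemma exp_sum_expR (x : R) : (fun K => exp_sum K x) @ \oo --> expR x.
Proof.
have -> : (fun K => exp_sum K x) = series (exp_coeff x).
  apply/funext => K; rewrite /series/= big_mkord.
  by apply: eq_bigr => i _; rewrite mulrC.
exact: is_cvg_series_exp_coeff.
Qed.

(** The parity of k separates the powers of i into the coefficients of the
    cosine and of the sine series. *)
Lemma exp_sum_imag (y : R) :
  (fun K => exp_sum K ('i%C * y%:C)) @ \oo --> cos y +i* sin y.
Proof.
have -> : (fun K => exp_sum K ('i%C * y%:C)) =
  (fun K => series (cos_coeff y) K +i* series (sin_coeff y) K).
  apply/funext => K; rewrite /series/= !big_mkord [RHS]complexE/= !rmorph_sum.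
  rewrite mulr_sumr -big_split/=; apply: eq_bigr => k _.
  rewrite exprMn /cos_coeff /sin_coeff /=.
  have -> : ('i%C : C) ^+ k = if odd k then 'i%C * (-1) ^+ k./2 else (-1)
    ^+ k./2.
    rewrite -[in LHS](odd_double_half k) exprD -mul2n exprM sqr_i.
    by case: odd; rewrite ?expr1 ?expr0 ?mul1r.
  have fC : (k`!%:R : C)^-1 = ((k`!%:R)^-1 : R)%:C
    by rewrite fmorphV rmorph_nat.
  have N1 h : (-1 : C) ^+ h = ((-1) ^+ h : R)%:C by rewrite rmorphXn rmorphN1.
  rewrite fC !N1 -rmorphXn; case: ifPn => k_odd /=.
    have -> : k.-1./2 = k./2.
      by rewrite -[in LHS](odd_double_half k) k_odd/= doubleK.
    by rewrite !mul0r mul1r rmorph0 add0r !rmorphM; ring.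
  by rewrite !mul0r mul1r rmorph0 mulr0 addr0 !rmorphM; ring.
apply: cvg_complex; rewrite unlock.
- exact: is_cvg_series_cos_coeff.
- exact: is_cvg_series_sin_coeff.
Qed.

(** The product of the partial sums at x and i y tends to [cexp], and its distance
    to the partial sum at x + i y is at most
    S_K |x| * S_K |y| - S_K (|x| + |y|), which tends to
    exp |x| * exp |y| - exp (|x| + |y|) = 0. *)
Lemma exp_sum_cvg z : (fun K => exp_sum K z) @ \oo --> cexp z.
Proof.
have -> : z = (Re z)%:C + 'i%C * (Im z)%:C by rewrite -complexE.
set x := Re z; set y := Im z.
have -> : cexp (x%:C + 'i%C * y%:C) = (expR x)%:C * (cos y +i* sin y).
  by rewrite /cexp; simpc.
have pcvg : (fun K => exp_sum K x%:C * exp_sum K ('i%C * y%:C)) @ \oo -->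
    (expR x)%:C * (cos y +i* sin y).
  apply: cvgM; last exact: (@exp_sum_imag y).
  under eq_fun do rewrite exp_sum_real.
  exact: (cvg_comp _ _ (@exp_sum_expR x) (@continuous_real_complex _ _)).
suff dcvg : (fun K => exp_sum K x%:C * exp_sum K ('i%C * y%:C) -
     exp_sum K (x%:C + 'i%C * y%:C)) @ \oo --> (0 : C).
  rewrite -[X in _ --> X]subr0.
  have -> : (fun K => exp_sum K (x%:C + 'i%C * y%:C)) =
      (fun K => exp_sum K x%:C * exp_sum K ('i%C * y%:C) -
        (exp_sum K x%:C * exp_sum K ('i%C * y%:C)
          - exp_sum K (x%:C + 'i%C * y%:C))).
    by apply/funext => K; rewrite subKr.
  exact: (cvgB pcvg dcvg).
have nC (t : R) : `|t%:C| = `|t|%:C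
  by rewrite normc_def/= expr0n addr0 sqrtr_sqr.
have bound : (fun K => (exp_sum K `|x| *
  exp_sum K `|y| - exp_sum K (`|x| + `|y|))%:C)
    @ \oo --> (0 : C).
  have : (fun K => exp_sum K `|x| * exp_sum K `|y| - exp_sum K (`|x| + `|y|))
    @ \oo -->
      expR `|x| * expR `|y| - expR (`|x| + `|y|).
    by apply: cvgB; [apply: cvgM|]; exact: exp_sum_expR.
  rewrite expRD subrr => h.
  exact: (cvg_comp _ _ h (@continuous_real_complex _ _)).
apply/cvgrPdist_lt => e e0; near=> K.
rewrite sub0r normrN; apply: le_lt_trans (exp_sum_norm_le _ _ _) _.
rewrite normrM !nC.
have -> : `|'i%C : C| = 1.
  by rewrite normc_def/= expr0n expr1n add0r sqrtr1.
rewrite mul1r -rmorphD !exp_sum_real -rmorphM -rmorphB.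
rewrite -[ltLHS]ger0_norm; last first.
  rewrite ler0c; have := exp_sum_norm_le K `|x| `|y|.
  by rewrite !normr_id; apply: le_trans; exact: normr_ge0.
rewrite -normrN -[X in `|X|]sub0r; near: K.
exact: (@cvgr_dist_lt _ _ _ _ _ _ _ bound).
Unshelve. all: by end_near. Qed.

End ComplexExponential.

(** * A complex logarithm *)

Section ComplexLogarithm.
Variable R : realType.
Local Notation C := R[i].
Implicit Types z w : C.

Definition cmod z : R := Num.sqrt (Re z ^+ 2 + Im z ^+ 2).

Lemma cmod1 : cmod 1 = 1.
Proof. by rewrite /cmod/= expr1n expr0n addr0 sqrtr1. Qed.

(** The common part of the two constructions of logarithms below: an argument of
    z / |z| gives a logarithm of z. *)
Lemma cexp_polar z : z != 0 ->
  let u := Re z / cmod z in let v := Im z / cmod z in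
  [/\ 0 < cmod z, u ^+ 2 + v ^+ 2 = 1 &
      forall t, cos t = u -> sin t = v -> cexp (ln (cmod z) +i* t) = z].
Proof.
case: z => a b z0; rewrite /cmod/=; set r := Num.sqrt _.
have r2 : r ^+ 2 = a ^+ 2 + b ^+ 2.
  by rewrite sqr_sqrtr// addr_ge0// sqr_ge0.
have r0 : 0 < r.
  rewrite lt_neqAle sqrtr_ge0 andbT eq_sym; apply: contraNN z0 => /eqP r0.
  have /eqP := r2; rewrite r0 expr0n eq_sym paddr_eq0 ?sqr_ge0// !sqrf_eq0.
  by move=> /andP[/eqP-> /eqP->].
have rn0 : r != 0 by rewrite gt_eqF.
split=> //; first by rewrite !expr_div_n -mulrDl -r2 divff// sqrf_eq0.
move=> t ct st; rewrite /cexp/= lnK ?posrE// ct st.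
by congr (_ +i* _); rewrite mulrC divfK.
Qed.

(** The argument is the arccosine of the real part of z / |z|, up to the sign of
    the imaginary part. *)
Lemma cexp_surj z : z != 0 -> exists w, cexp w = z.
Proof.
move=> /cexp_polar/=.
set u := Re z / _; set v := Im z / _ => -[r0 uv1 E].
have v2 : v ^+ 2 = 1 - u ^+ 2 by rewrite -uv1 addrC addKr.
have u11 : -1 <= u <= 1.
  rewrite -ler_norml -(@ler_pXn2r _ 2)// ?nnegrE// real_normK ?num_real// expr1n.
  by rewrite -subr_ge0 -v2 sqr_ge0.
have su : sin (acos u) = `|v| by rewrite sin_acos// -v2 sqrtr_sqr.
have cu : cos (acos u) = u by rewrite acosK// in_itv.
have [v0|v0] := leP 0 v.
  exists (ln (cmod z) +i* acos u); apply: E => //.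
  by rewrite su ger0_norm.
exists (ln (cmod z) +i* - acos u); apply: E; first by rewrite cosN.
by rewrite sinN su ltr0_norm// opprK.
Qed.

(** The explicit branch is needed for continuity at 1 and for clog 1 = 0; away from
    the right half-plane any logarithm serves. *)
Definition clog z : C :=
  if 0 < Re z then ln (cmod z) +i* asin (Im z / cmod z)
  else xget 0 [set w | cexp w = z].

Lemma clogK z : z != 0 -> cexp (clog z) = z.
Proof.
move=> z0; rewrite /clog; case: ifPn => [rz|_]; last first.
  have [w wz] := cexp_surj z0.
  by case: xgetP => [y _ //|/(_ w)]; case.
have /= := cexp_polar z0.
set u := Re z / _; set v := Im z / _ => -[r0 uv1 E].
have u2 : u ^+ 2 = 1 - v ^+ 2 by rewrite -uv1 addrK.
have v11 : -1 <= v <= 1.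
  rewrite -ler_norml -(@ler_pXn2r _ 2)// ?nnegrE// real_normK ?num_real// expr1n.
  by rewrite -subr_ge0 -u2 sqr_ge0.
apply: E; last by rewrite asinK// in_itv.
by rewrite cos_asin// -u2 sqrtr_sqr ger0_norm// divr_ge0// ltW.
Qed.

Lemma asin0 : asin (0 : R) = 0.
Proof.
rewrite -[in LHS](@sin0 R) sinK// in_itv/=.
by rewrite oppr_le0 divr_ge0 ?pi_ge0.
Qed.

Lemma clog1 : clog 1 = 0.
Proof. by rewrite /clog/= ltr01 cmod1 ln1 mul0r asin0. Qed.

Lemma clog_continuous1 : {for (1 : C), continuous clog}.
Proof.
have FF : Filter (nbhs (1 : C)) := nbhs_filter (1 : C).
have RT := @Re_continuous R 1; have IT := @Im_continuous R 1.
have NT : (cmod) @ (1 : C) --> (1 : R).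
  rewrite -[X in _ --> X]cmod1.
  have S := cvgD (cvgM RT RT) (cvgM IT IT).
  exact: (cvg_comp _ _ (S FF FF FF) (@sqrt_continuous R _)).
have near1 : \forall z \near (1 : C), 0 < Re z.
  by apply: (@cvgr_gt _ _ _ FF _ _ RT 0); rewrite ltr01.
rewrite /prop_for /continuous_at clog1.
have T : (fun z => ln (cmod z) +i* asin (Im z / cmod z)) @ (1 : C) --> (0 : C).
  apply: cvg_complex.
    rewrite -[X in _ --> X](@ln1 R).
    exact: (cvg_comp _ _ NT (continuous_ln ltr01)).
  rewrite -[X in _ --> X]asin0.
  have S := cvgM IT (cvgV (oner_neq0 R) NT).
  rewrite -[X in _ --> asin X](mul0r 1^-1).
  apply: (cvg_comp _ _ (S FF FF)); apply: continuous_asin.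
  by rewrite mul0r ltrN10 ltr01.
apply: cvg_trans T; apply: near_eq_cvg.
by near=> z; rewrite /clog ifT//; near: z.
Unshelve. all: by end_near. Qed.

End ComplexLogarithm.

(** * Polynomial logarithm of unipotent matrices *)

Section TruncatedInverse.
Variable F : fieldType.
Implicit Types f g h p q a b : {poly F}.

Lemma dvdp_compB p a b : a - b %| (p \Po a) - (p \Po b).
Proof.
rewrite !comp_polyE -sumrB.
elim/big_ind: _ => [|u v|i _]; [exact: dvdp0|exact: dvdp_add|].
rewrite -scalerBr subrXX -mul_polyC dvdp_mull//; exact: dvdp_mulIl.
Qed.

Lemma dvdp_X2_factor f : 'X^2 %| f - 'X -> exists h, f = 'X * (1 + 'X * h).
Proof.
move=> /dvdpP[h fh]; exists h; rewrite -[LHS](subrK 'X) fh; ring.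
Qed.

(** If g o f = X + c X^(k+2) modulo X^(k+3), then subtracting c X^(k+2) from g
    removes the error, since f^(k+2) = X^(k+2) modulo X^(k+3). *)
Lemma trunc_left_inverse f k : 'X^2 %| f - 'X ->
  exists2 g, 'X^2 %| g - 'X & 'X^(k.+2) %| (g \Po f) - 'X.
Proof.
move=> fX; elim: k => [|k [g gX /dvdpP[r gf]]].
  by exists 'X; rewrite ?comp_polyX// subrr dvdp0.
have [h fh] := dvdp_X2_factor fX.
(* r.[0] is the coefficient of X^(k+2) in the error of g. *)
exists (g - r.[0] *: 'X^(k.+2)).
  rewrite addrAC; apply: dvdp_sub => //.
  by rewrite -mul_polyC dvdp_mull// dvdp_exp2l.
rewrite comp_polyB comp_polyZ comp_Xn_poly addrAC gf fh exprMn -mul_polyC.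
have -> : r * 'X^(k.+2) - r.[0]%:P * ('X^(k.+2) * (1 + 'X * h) ^+ k.+2) =
    (r - r.[0]%:P * (1 + 'X * h) ^+ k.+2) * 'X^(k.+2) by ring.
rewrite (exprS 'X (k.+2)); apply: dvdp_mul => //.
rewrite -[X in X %| _]subr0 -polyC0 dvdp_XsubCl /root.
by rewrite hornerD hornerN hornerM hornerC horner_exp hornerD hornerC hornerM
  hornerX mul0r addr0 expr1n mulr1 subrr.
Qed.

(** A left inverse g has itself a left inverse h, and h = h o g o f = f modulo X^m,
    so that g is also a right inverse. *)
Lemma trunc_inverse f m : 'X^2 %| f - 'X ->
  exists g, [/\ 'X^2 %| g - 'X, 'X^m %| (g \Po f) - 'X & 'X^m %| (f \Po g)
    - 'X].
Proof.
move=> fX.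
have [g gX gf] := trunc_left_inverse m fX.
have [h hX hg] := trunc_left_inverse m gX.
have leM : (m <= m.+2)%N by rewrite -addn2 leq_addr.
have Xpow p : 'X^2 %| p - 'X -> 'X^(m.+2) %| p ^+ m.+2.
  move=> /dvdp_X2_factor[q ->]; rewrite exprMn; exact: dvdp_mulIl.
(* h = h o (g o f) = (h o g) o f = f modulo X^(m+2). *)
have hf : 'X^(m.+2) %| h - f.
  have -> : h - f = ((h \Po g) \Po f - f) - ((h \Po (g \Po f)) - (h \Po 'X)).
    by rewrite comp_polyXr comp_polyA; ring.
  apply: dvdp_sub; last exact: (dvdp_trans gf (dvdp_compB _ _ _)).
  rewrite -[X in _ - X](comp_polyX f) -comp_polyB.
  have := dvdp_comp_poly f hg; rewrite comp_Xn_poly; apply: dvdp_trans.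
  exact: Xpow.
exists g; split=> //; apply: (dvdp_trans (dvdp_exp2l 'X leM)) => //.
have -> : (f \Po g) - 'X = ((h \Po g) - 'X) - ((h - f) \Po g).
  by rewrite comp_polyB; ring.
apply: dvdp_sub => //.
have := dvdp_comp_poly g hf; rewrite comp_Xn_poly; apply: dvdp_trans.
exact: Xpow.
Qed.

End TruncatedInverse.

Section NilpotentLog.
Variable F : numFieldType.

Lemma trunc_expX_split m : exists q : {poly F},
  trunc_exp m.+2 ('X : {poly F}) = 1 + 'X + 'X^2 * q.
Proof.
rewrite /trunc_exp 2!big_ord_recl/= fact0 invr1 !scale1r expr0 expr1.
exists (\sum_(i < m) (i.+2`!%:R)^-1 *: 'X^i).
rewrite addrA mulr_sumr; congr (_ + _); apply: eq_bigr => i _.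
by rewrite -scalerAr -exprD.
Qed.

Lemma horner_mx_trunc_exp n (N : 'M[F]_n.+1) m :
  horner_mx N (trunc_exp m ('X : {poly F})) = trunc_exp m N.
Proof.
rewrite /trunc_exp rmorph_sum; apply: eq_bigr => i _.
by rewrite /= linearZ/= rmorphXn/= horner_mx_X.
Qed.

Lemma horner_mx_comp n (N : 'M[F]_n.+1) (p q : {poly F}) :
  horner_mx N (p \Po q) = horner_mx (horner_mx N q) p.
Proof.
elim/poly_ind: p => [|p c IH]; first by rewrite comp_poly0 !rmorph0.
by rewrite comp_poly_MXaddC !rmorphD !rmorphM/= IH !horner_mx_C horner_mx_X.
Qed.

Lemma horner_mx_nilp n (N : 'M[F]_n.+1) m (p q : {poly F}) :
  N ^+ m = 0 -> 'X^m %| p - q -> horner_mx N p = horner_mx N q.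
Proof.
move=> N0 /dvdpP[r /eqP]; rewrite subr_eq => /eqP->.
by rewrite rmorphD rmorphM rmorphXn/= horner_mx_X N0 mulr0 add0r.
Qed.

(** The truncated exponential minus 1 is X modulo X^2, hence has a compositional
    inverse g modulo X^m, which evaluates on nilpotent matrices to the logarithm:
    one polynomial for all of them, so that it is continuous, and so that log N
    commutes with whatever commutes with N. Divisibility of g by X says that the
    logarithm of 1 is 0. *)
Lemma nilpotent_log m : exists g : {poly F}, 'X %| g /\
  forall n (N : 'M[F]_n.+1), N ^+ m = 0 ->
    horner_mx (trunc_exp m.+2 N - 1) g = N /\
    trunc_exp m.+2 (horner_mx N g) = 1 + N.
Proof.
have [q Tq] := trunc_expX_split m.
pose T := trunc_exp m.+2 ('X : {poly F}) - 1.
have TX : 'X^2 %| T - 'X.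
  by rewrite /T Tq; apply/dvdpP; exists q; ring.
have [g [gX gT Tg]] := trunc_inverse m TX.
exists g; split.
  by have [h ->] := dvdp_X2_factor gX; exact: dvdp_mulIl.
move=> n N N0; have Tmx M : horner_mx M T = trunc_exp m.+2 M - 1.
  by rewrite /T rmorphB rmorph1/= horner_mx_trunc_exp.
split.
  by rewrite -Tmx -horner_mx_comp (horner_mx_nilp N0 gT) horner_mx_X.
have := horner_mx_nilp N0 Tg; rewrite horner_mx_comp Tmx horner_mx_X.
by move=> /eqP; rewrite subr_eq addrC => /eqP.
Qed.

End NilpotentLog.

(** * Limits of matrices and closed subspaces *)

Section MatrixTopology.
Variable K : numFieldType.

Lemma cvg_mx (T : Type) (F : set_system T) {FF : Filter F} m n
    (f : T -> 'M[K]_(m, n)) (M : 'M[K]_(m, n)) :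
  (forall i j, (fun x => f x i j) @ F --> M i j) -> f @ F --> M.
Proof.
move=> fM A [P MP PA].
have : \forall x \near F, forall ij : 'I_m * 'I_n, P ij.1 ij.2 (f x ij.1 ij.2).
  by apply: filter_forall => -[i j] /=; exact: fM (MP i j).
by apply: filterS => x Px; apply: PA => i j; exact: (Px (i, j)).
Qed.

Lemma cvg_coord (T : Type) (F : set_system T) {FF : Filter F} m n
    (f : T -> 'M[K]_(m, n)) (M : 'M[K]_(m, n)) i j :
  f @ F --> M -> (fun x => f x i j) @ F --> M i j.
Proof. by move=> fM; exact: (cvg_comp _ _ fM (@coord_continuous K m n i j M)).
  Qed.

Lemma cvg_bigsum (T : Type) (F : set_system T) {FF : Filter F} (I : Type)
    (V : normedModType K) (r : seq I) (P : pred I) (f : I -> T -> V)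
      (a : I -> V) :
  (forall i, P i -> f i @ F --> a i) ->
  (fun x => \sum_(i <- r | P i) f i x) @ F --> \sum_(i <- r | P i) a i.
Proof.
move=> fa; elim: r => [|i r IH].
  by under eq_fun do rewrite big_nil; rewrite big_nil; exact: cvg_cst.
under eq_fun do rewrite big_cons; rewrite big_cons.
by case: ifP => // Pi; apply: cvgD => //; exact: fa.
Qed.

Lemma cvg_mulmx (T : Type) (F : set_system T) {FF : Filter F} m n p
    (f : T -> 'M[K]_(m, n)) (g : T -> 'M[K]_(n, p)) (A : 'M[K]_(m, n))
      (B : 'M[K]_(n, p)) :
  f @ F --> A -> g @ F --> B -> (fun x => f x *m g x) @ F --> A *m B.
Proof.
move=> fA gB; apply: cvg_mx => i j.
under eq_fun do rewrite mxE; rewrite mxE.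
by apply: cvg_bigsum => k _; apply: cvgM; exact: cvg_coord.
Qed.

Lemma cvg_mx_exp (T : Type) (F : set_system T) {FF : Filter F} n
    (f : T -> 'M[K]_n) (A : 'M[K]_n) k : f @ F --> A -> (fun x => f x ^+ k)
      @ F --> A ^+ k.
Proof.
move=> fA; elim: k => [|k IH].
  by under eq_fun do rewrite expr0; exact: cvg_cst.
by under eq_fun do rewrite exprS; rewrite exprS; exact: cvg_mulmx.
Qed.

Lemma cvg_mx_scale (T : Type) (F : set_system T) {FF : Filter F} m n
    (f : T -> 'M[K]_(m, n)) (A : 'M[K]_(m, n)) (a : K) :
  f @ F --> A -> (fun x => a *: f x) @ F --> a *: A.
Proof.
move=> fA; apply: cvg_mx => i j; under eq_fun do rewrite mxE; rewrite mxE.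
by apply: cvgM; [exact: cvg_cst|exact: cvg_coord].
Qed.

Lemma cvg_mxD (T : Type) (F : set_system T) {FF : Filter F} m n
    (f g : T -> 'M[K]_(m, n)) (A B : 'M[K]_(m, n)) :
  f @ F --> A -> g @ F --> B -> (fun x => f x + g x) @ F --> A + B.
Proof.
move=> fA gB; apply: cvg_mx => i j; under eq_fun do rewrite mxE; rewrite mxE.
by apply: cvgD; exact: cvg_coord.
Qed.

Lemma cvg_trunc_exp (T : Type) (F : set_system T) {FF : Filter F} n
    (f : T -> 'M[K]_n.+1) (A : 'M[K]_n.+1) k :
  f @ F --> A -> (fun x => trunc_exp k (f x)) @ F --> trunc_exp k A.
Proof.
move=> fA; apply: (@cvg_bigsum T F FF _ 'M[K]_n.+1 _ _
  (fun (i : 'I_k) x => (i`!%:R)^-1 *: f x ^+ i)) => i _.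
by apply: cvg_mx_scale; exact: cvg_mx_exp.
Qed.

(** The inclusion is only required near w: f will involve a logarithm, which
    inverts the exponential on invertible matrices only. *)
Lemma closure_map (X Y : topologicalType) (B : set X) (C : set Y) (f : X -> Y)
  w v :
  closure B w -> f @ w --> v -> (\forall y \near w, B y -> C (f y)) ->
  closure C v.
Proof.
move=> clB fv BC U vU.
have [y [By [Cfy Uy]]] := clB _ (filterI BC (fv _ vU)).
by exists (f y); split => //; exact: Cfy.
Qed.

Lemma closure_idem (X : topologicalType) (B : set X) w :
  closure (closure B) w -> closure B w.
Proof. by rewrite -(iffLR (closure_id (closure B)) (@closed_closure _ B)). Qed.

Definition linear_set m (T : set 'cV[K]_m) :=
  T 0 /\ forall a x y, T x -> T y -> T (a *: x + y).

(** Take M of maximal rank among the square matrices whose transposed rows are in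
    T: a vector of T outside the row space of M would increase the rank. *)
Lemma linear_set_rowspace m (T : set 'cV[K]_m) : linear_set T ->
  exists M : 'M[K]_m, forall x, T x <-> (x^T <= M)%MS.
Proof.
move=> [T0 TD].
have Tsum M (x : 'cV[K]_m) : (forall i : 'I_m, T (row i M)^T)
  -> (x^T <= M)%MS -> T x.
  move=> rowT /submxP[D xD]; rewrite -[x]trmxK xD mulmx_sum_row linear_sum/=.
  elim/big_ind: _ => [//|u v Tu Tv|i _].
    by rewrite -[u]scale1r; exact: TD.
  by rewrite linearZ/= -[_ *: _]addr0; exact: TD.
pose ranks k := `[< exists2 M : 'M[K]_m, (forall i, T (row i M)^T) & \rank M =
  k >].
have exr : exists k, ranks k.
  exists 0%N; apply/asboolP; exists 0; last exact: mxrank0.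
  by move=> i; rewrite row0 trmx0.
have ubr k : ranks k -> (k <= m)%N.
  by move=> /asboolP[M _ <-]; exact: rank_leq_row.
have [k /asboolP[M MT Mk] kmax] := ex_maxnP exr ubr.
exists M => x; split; last exact: Tsum.
move=> Tx; apply/negPn/negP => xM.
have : ranks (\rank (x^T + M)%MS).
  apply/asboolP; exists (x^T + M)%MS => // i.
  have /sub_addsmxP[[u v] /= ->] := row_sub i (x^T + M)%MS.
  rewrite linearD/= trmx_mul trmxK.
  have -> : x *m u^T = u 0 0 *: x.
    by apply/matrixP => a b; rewrite !mxE big_ord1 !mxE !ord1 mulrC.
  apply: TD => //; apply: (Tsum M) => //; rewrite trmxK; exact: submxMl.
move=> /kmax; rewrite leqNgt -Mk => /negP; apply.
apply: rank_ltmx; rewrite ltmxE addsmxSr addsmx_sub.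
by rewrite negb_and xM.
Qed.

(** A subspace is the zero set of the linear forms given by the cokernel of a
    matrix that generates it. *)
Lemma linear_set_closed m (T : set 'cV[K]_m) w :
  linear_set T -> closure T w -> T w.
Proof.
move=> /linear_set_rowspace[M TM] clT; apply/TM; rewrite submxE.
apply/eqP/matrixP => i j; rewrite [RHS]mxE.
have FF : Filter (nbhs w) := nbhs_filter w.
have cl0 : closure [set (0 : K)] ((w^T *m cokermx M) i j).
  apply: (@closure_map 'cV[K]_m K T [set 0] (fun y => (y^T *m cokermx M) i j) w)
    => //.
    have wT : (fun y : 'cV[K]_m => y^T) @ w --> w^T.
      apply: cvg_mx => a b; under eq_fun do rewrite mxE; rewrite mxE.
      exact: coord_continuous.
    have wM := cvg_mulmx wT (@cvg_cst _ (cokermx M) _ (nbhs w) FF).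
    exact: (cvg_coord (wM FF)).
  apply: (@nearW _ _ _ FF) => y /TM; rewrite submxE => /eqP ->.
  by rewrite mxE.
have c0 : closed [set (0 : K)]
  by apply: accessible_closed_set1; apply: hausdorff_accessible;
  exact: norm_hausdorff.
by move: cl0; rewrite -(iffLR (closure_id _) c0).
Qed.

End MatrixTopology.

(** * Block triangular matrices *)

(** A partition of the indices into blocks, given by the map sending an index to the
    first index of its block. This avoids the casts of block matrices: two indices
    are in the same block when they have the same head. *)
Record block_map (n : nat) := BlockMap {
  block_head :> 'I_n.+1 -> 'I_n.+1;
  block_head_le : forall i, (block_head i <= i)%N;
  block_head_idem : forall i, block_head (block_head i) = block_head i
}.

Section BlockAlgebra.
Variables (R : realType) (n : nat).
Local Notation C := R[i].
Local Notation m := n.+1.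
Variable s : block_map n.
Implicit Types (M N X Y : 'M[C]_m) (c : 'I_m -> C).

Definition respects_blocks M :=
  forall i j : 'I_m, M i j != 0 -> (j <= i)%N /\ s j = s i.

(** The algebra [KK], described without block matrices: see [KKP]. *)
Definition block_trig M := respects_blocks M /\ forall i, M i i = M (s i) (s i).

(** The eigenvalue of M on the block of i. *)
Definition head_eig M i : C := M (s i) (s i).

Definition head_diag c : 'M[C]_m := diag_mx (\row_i c (s i)).

Definition nilpart M := M - head_diag (head_eig M).

Definition strictly_trig N := forall i j : 'I_m, N i j != 0 -> (j < i)%N.

Lemma block_head0 : s ord0 = ord0.
Proof. by apply/val_inj/eqP; rewrite -leqn0 (block_head_le s ord0). Qed.

Lemma head_diagE c i j : head_diag c i j = c (s i) *+ (i == j).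
Proof. by rewrite !mxE. Qed.

Lemma eq_head_diag c d : (forall i, c (s i) = d (s i)) -> head_diag c =
  head_diag d.
Proof. by move=> cd; apply/matrixP => i j; rewrite !head_diagE cd. Qed.

Lemma block_trig_diag c : block_trig (head_diag c).
Proof.
split=> [i j|i]; last by rewrite !head_diagE !eqxx block_head_idem.
by rewrite head_diagE; have [->|_] := eqVneq i j; rewrite ?eqxx// leqnn.
Qed.

Lemma head_eig_diag c i : head_eig (head_diag c) i = c (s i).
Proof. by rewrite /head_eig head_diagE eqxx block_head_idem. Qed.

(** Such a diagonal matrix is scalar on each block. *)
Lemma head_diagC c M : respects_blocks M -> head_diag c * M = M * head_diag c.
Proof.
move=> bM; apply/matrixP => i j; rewrite -!mulmxE mul_diag_mx mul_mx_diag !mxE.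
have [->|/bM[_ ->]] := eqVneq (M i j) 0; first by rewrite mulr0 mul0r.
by rewrite mulrC.
Qed.

Lemma head_diagM c d : head_diag (fun i => c i * d i) = head_diag c *
  head_diag d.
Proof.
rewrite -mulmxE mulmx_diag; congr diag_mx.
by apply/matrixP => i j; rewrite !mxE.
Qed.

Lemma head_diag1 : head_diag (fun=> 1) = 1.
Proof. by apply/matrixP => i j; rewrite head_diagE !mxE. Qed.

Lemma head_diagD c d : head_diag (fun i => c i + d i)
  = head_diag c + head_diag d.
Proof. by apply/matrixP => i j; rewrite !(head_diagE, mxE) mulrnDl;
  congr (_ + _); case: eqP => // ->. Qed.

Lemma head_diagZ a c : head_diag (fun i => a * c i) = a *: head_diag c.
Proof. by apply/matrixP => i j; rewrite !(head_diagE, mxE) mulrnAr;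
  case: eqP => // ->. Qed.

Lemma head_diagX c k : head_diag c ^+ k = head_diag (fun i => c i ^+ k).
Proof.
elim: k => [|k IH]; first by rewrite expr0 -head_diag1.
by rewrite exprS IH -head_diagM; apply: eq_head_diag => i; rewrite exprS.
Qed.

Lemma head_diag_sum (I : Type) (r : seq I) (P : pred I) (F : I -> 'I_m -> C) :
  \sum_(k <- r | P k) head_diag (F k)
    = head_diag (fun i => \sum_(k <- r | P k) F k i).
Proof.
apply/matrixP => i j; rewrite summxE head_diagE -sumrMnl.
by apply: eq_bigr => k _; rewrite head_diagE.
Qed.


Lemma block_trig0 : block_trig 0.
Proof. by split=> [i j|i]; rewrite !mxE// eqxx. Qed.

Lemma block_trig1 : block_trig 1.
Proof. by rewrite -head_diag1; exact: block_trig_diag. Qed.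

Lemma block_trigD M N : block_trig M -> block_trig N -> block_trig (M + N).
Proof.
move=> [bM dM] [bN dN]; split=> [i j|i]; last by rewrite !mxE dM dN.
rewrite mxE; have [->|/bM//] := eqVneq (M i j) 0.
by rewrite add0r => /bN.
Qed.

Lemma block_trigZ a M : block_trig M -> block_trig (a *: M).
Proof.
move=> [bM dM]; split=> [i j|i]; last by rewrite !mxE dM.
by rewrite mxE mulf_eq0 negb_or => /andP[_ /bM].
Qed.

Lemma block_trigN M : block_trig M -> block_trig (- M).
Proof. by rewrite -scaleN1r; exact: block_trigZ. Qed.

Lemma sum_neq0 (I : finType) (F : I -> C) :
  \sum_i F i != 0 -> exists i, F i != 0.
Proof.
move=> F0; apply/existsP; apply: contraNT F0;
  rewrite negb_exists => /forallP F0.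
by rewrite big1// => i _; apply/eqP; move: (F0 i); rewrite negbK.
Qed.

Lemma mul_diag_entry M N i : respects_blocks M -> respects_blocks N ->
  (M * N) i i = M i i * N i i.
Proof.
move=> bM bN; rewrite -mulmxE mxE (bigD1 i)//= big1 ?addr0// => k ki.
apply/eqP; rewrite mulf_eq0; apply: contraNT ki; rewrite negb_or.
move=> /andP[/bM[ki _] /bN[ik _]]; apply/eqP/val_inj/eqP.
by rewrite eqn_leq ki ik.
Qed.

Lemma block_trigM M N : block_trig M -> block_trig N -> block_trig (M * N).
Proof.
move=> [bM dM] [bN dN]; split=> [i j|i];
  last by rewrite !mul_diag_entry// dM dN.
rewrite -mulmxE mxE => /sum_neq0[k]; rewrite mulf_eq0 negb_or.
move=> /andP[/bM[ki sk] /bN[jk ->]]; split=> //; exact: leq_trans jk ki.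
Qed.

Lemma head_eigM M N i : block_trig M -> block_trig N -> head_eig (M * N) i =
  head_eig M i * head_eig N i.
Proof. by move=> [bM _] [bN _]; rewrite /head_eig mul_diag_entry. Qed.

Lemma block_trigX M k : block_trig M -> block_trig (M ^+ k).
Proof.
move=> KM; elim: k => [|k IH]; first by rewrite expr0; exact: block_trig1.
by rewrite exprS; exact: block_trigM.
Qed.

Lemma block_trig_sum (I : Type) (r : seq I) (P : pred I) (F : I -> 'M[C]_m) :
  (forall k, P k -> block_trig (F k)) -> block_trig (\sum_(k <- r | P k) F k).
Proof.
by move=> KF; elim/big_ind: _ => //; [exact: block_trig0|exact: block_trigD].
Qed.

Lemma block_trig_horner M (p : {poly C}) : block_trig M ->
  block_trig (horner_mx M p).
Proof.
move=> KM; elim/poly_ind: p => [|p c IH]; first by rewrite rmorph0;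
  exact: block_trig0.
rewrite rmorphD rmorphM/= horner_mx_X horner_mx_C -scalemx1.
by apply: block_trigD; [exact: block_trigM|apply: block_trigZ;
  exact: block_trig1].
Qed.

Lemma block_trig_trunc_exp M k : block_trig M -> block_trig (trunc_exp k M).
Proof. by move=> KM; apply: block_trig_sum => i _; apply: block_trigZ;
  exact: block_trigX. Qed.

Lemma block_trig_nilpart M : block_trig M -> block_trig (nilpart M).
Proof. by move=> KM; apply: block_trigD => //; apply: block_trigN;
  exact: block_trig_diag. Qed.

Lemma strictly_trig_nilpart M : block_trig M -> strictly_trig (nilpart M).
Proof.
move=> [bM dM] i j; rewrite /nilpart !mxE.
have [ij|ij] := eqVneq i j.
  by rewrite -ij dM /head_eig block_head_idem subrr eqxx.
rewrite mulr0n subr0 => /bM[ji _]; rewrite ltn_neqAle ji andbT eq_sym.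
exact: ij.
Qed.

Lemma nilpartK M : head_diag (head_eig M) + nilpart M = M.
Proof. by rewrite addrC subrK. Qed.

(** Each factor N moves the indices down by at least one. *)
Lemma strictly_trigX_band N k i j : strictly_trig N -> (N ^+ k) i j != 0 ->
  (j + k <= i)%N.
Proof.
move=> sN; elim: k i => [|k IH] i.
  by rewrite expr0 mxE addn0; have [->//|_] := eqVneq i j; rewrite eqxx.
rewrite exprS -mulmxE mxE => /sum_neq0[l]; rewrite mulf_eq0 negb_or.
by move=> /andP[/sN li /IH]; rewrite addnS => /leq_ltn_trans; apply.
Qed.

Lemma strictly_trigXM0 M N a b : strictly_trig M -> strictly_trig N ->
  (m <= a + b)%N ->
  M ^+ a * N ^+ b = 0.
Proof.
move=> sM sN mab; apply/matrixP => i j; rewrite [RHS]mxE.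
apply/eqP; apply: contraTT mab; rewrite -mulmxE mxE => /sum_neq0[l].
rewrite mulf_eq0 negb_or => /andP[/(strictly_trigX_band sM)
  li /(strictly_trigX_band sN) jl].
rewrite -ltnNge; apply: leq_ltn_trans (ltn_ord i).
by apply: leq_trans li; rewrite addnC leq_add2r (leq_trans _ jl)// leq_addl.
Qed.

Lemma strictly_trigX0 N a : strictly_trig N -> (m <= a)%N -> N ^+ a = 0.
Proof.
by move=> sN ma; have := @strictly_trigXM0 N N a 0 sN sN; rewrite addn0 mulr1;
  apply.
Qed.

Lemma strictly_trigD M N : strictly_trig M -> strictly_trig N ->
  strictly_trig (M + N).
Proof.
move=> sM sN i j; rewrite mxE; have [->|/sM//] := eqVneq (M i j) 0.
by rewrite add0r => /sN.
Qed.

(** All the terms of total degree at least k in the product are 0. *)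
Lemma trunc_expD M N k : (m <= k)%N -> strictly_trig M -> strictly_trig N -> M *
  N = N * M ->
  trunc_exp k (M + N) = trunc_exp k M * trunc_exp k N.
Proof.
move=> mk sM sN MN; rewrite trunc_expM// -[LHS]addr0; congr (_ + _).
rewrite big1// => i _; rewrite big_nat_cond big1// => j /andP[/andP[ij _] _].
rewrite -scalerAl -scalerAr strictly_trigXM0 ?scaler0//.
by rewrite (leq_trans mk)// -leq_subLR.
Qed.

Lemma strictly_trig_diag N i : strictly_trig N -> N i i = 0.
Proof.
by move=> sN; apply/eqP; apply/negPn/negP => /sN; rewrite ltnn.
Qed.

End BlockAlgebra.

(** * The exponential of a block triangular matrix *)

Section BlockExponential.
Variables (R : realType) (n : nat) (s : block_map n).
Local Notation C := R[i].
Local Notation m := n.+1.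
Implicit Types (M N X Y : 'M[C]_m) (c : 'I_m -> C).

Definition block_exp M := head_diag s (fun i => cexp (head_eig s M i))
  * trunc_exp n.+3 (nilpart s M).

Lemma block_trig_exp M : block_trig s M -> block_trig s (block_exp M).
Proof.
move=> KM; apply: block_trigM; first exact: block_trig_diag.
exact/block_trig_trunc_exp/block_trig_nilpart.
Qed.

Lemma trunc_exp_diag1 N k i : strictly_trig N -> trunc_exp k.+1 N i i = 1.
Proof.
move=> sN;
  rewrite /trunc_exp summxE big_ord_recl/= fact0 invr1 scale1r expr0 mxE eqxx.
rewrite big1 ?addr0// => j _; rewrite mxE.
have [->|/(strictly_trigX_band sN)] := eqVneq ((N ^+ bump 0 j) i i) 0.
  by rewrite mulr0.
by rewrite /bump/= add1n addnS ltnNge leq_addr.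
Qed.

Lemma head_eig_exp M i : block_trig s M -> head_eig s (block_exp M) i =
  cexp (head_eig s M i).
Proof.
move=> KM; rewrite head_eigM;
  [|exact: block_trig_diag|exact/block_trig_trunc_exp/block_trig_nilpart].
rewrite head_eig_diag {2}/head_eig trunc_exp_diag1 ?mulr1;
  last exact: (strictly_trig_nilpart (s := s)).
by rewrite /head_eig block_head_idem.
Qed.

Lemma nilpart_diagD c N : strictly_trig N -> nilpart s (head_diag s c + N) = N.
Proof.
move=> sN; rewrite /nilpart.
have -> : head_diag s (head_eig s (head_diag s c + N)) = head_diag s c.
  apply: eq_head_diag => i; rewrite /head_eig mxE (strictly_trig_diag _ sN)
    addr0 block_head_idem.
  by rewrite head_diagE eqxx block_head_idem.
by rewrite addrC addKr.
Qed.

Lemma head_eig_diagD c N i : strictly_trig N -> head_eig s (head_diag s c + N)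
  i = c (s i).
Proof.
by move=> sN; rewrite /head_eig mxE (strictly_trig_diag _ sN)
  addr0 head_diagE eqxx block_head_idem.
Qed.

Lemma block_exp_diagD c N : strictly_trig N ->
  block_exp (head_diag s c + N) = head_diag s (fun i => cexp (c i))
    * trunc_exp n.+3 N.
Proof.
move=> sN; rewrite /block_exp nilpart_diagD//; congr (_ * _);
  apply: eq_head_diag => i.
by rewrite head_eig_diagD// block_head_idem.
Qed.

Lemma nilpart_comm M Y : block_trig s Y -> Y * M = M * Y ->
  Y * nilpart s M = nilpart s M * Y.
Proof. by move=> KY YM; rewrite /nilpart mulrBl mulrBr YM (head_diagC _ KY.1).
  Qed.

Lemma block_exp_comm M Y : block_trig s M -> block_trig s Y -> Y * M = M * Y ->
  Y * block_exp M = block_exp M * Y.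
Proof.
move=> KM KY YM; have YN : GRing.comm Y (nilpart s M) by exact: nilpart_comm.
rewrite /block_exp mulrA -(head_diagC _ KY.1) -!mulrA; congr (_ * _).
rewrite mulr_sumr mulr_suml; apply: eq_bigr => i _.
by rewrite -scalerAl -scalerAr (commrX _ YN).
Qed.

(** The diagonal parts commute with everything, and the nilpotent parts commute
    with each other, as polynomials in the matrices and their diagonal parts. *)
Lemma block_expD M N : block_trig s M -> block_trig s N -> M * N = N * M ->
  block_exp (M + N) = block_exp M * block_exp N.
Proof.
move=> KM KN MN; have sM := strictly_trig_nilpart KM; have sN :=
  strictly_trig_nilpart KN.
have nMN : nilpart s M * nilpart s N = nilpart s N * nilpart s M.
  apply: nilpart_comm; first exact: block_trig_nilpart.
  by apply/esym/nilpart_comm.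
rewrite -{1}(nilpartK s M) -{1}(nilpartK s N) addrACA -head_diagD.
rewrite block_exp_diagD; last exact: strictly_trigD.
rewrite (trunc_expD (leqW (leqnSn _)) sM sN nMN).
rewrite /block_exp -!mulrA [trunc_exp _ _ * (head_diag s _ * _)]mulrA.
rewrite -(head_diagC _ (block_trig_trunc_exp _ (block_trig_nilpart KM)).1)
  -!mulrA [RHS]mulrA -head_diagM.
by congr (_ * _); apply: eq_head_diag => i; rewrite cexpD.
Qed.

Lemma block_exp0 : block_exp 0 = 1.
Proof.
have s0 : strictly_trig (0 : 'M[C]_m) by move=> i j; rewrite mxE eqxx.
rewrite -[X in block_exp X]addr0 -[X in block_exp (X + _)](_ :
  head_diag s (fun=> 0) = 0).
  rewrite block_exp_diagD// (eq_head_diag (d := fun=> 1)) ?head_diag1 ?mul1r;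
    last by rewrite cexp0.
  rewrite /trunc_exp big_ord_recl big1 ?addr0; last first.
    by move=> i _; rewrite exprS mul0r scaler0.
  by rewrite fact0 invr1 scale1r expr0.
by apply/matrixP => i j; rewrite head_diagE mxE mul0rn.
Qed.

Lemma cvg_head_diag (T : Type) (F : set_system T) {FF : Filter F}
    (f : T -> 'I_m -> C) (a : 'I_m -> C) :
  (forall i, (fun x => f x i) @ F --> a i) -> (fun x => head_diag s (f x))
    @ F --> head_diag s a.
Proof.
move=> fa; apply: cvg_mx => i j; under eq_fun do rewrite head_diagE;
  rewrite head_diagE.
case: (i == j); last by under eq_fun do rewrite mulr0n; exact: cvg_cst.
by under eq_fun do rewrite mulr1n; exact: fa.
Qed.

Lemma head_eig_continuous i : continuous (fun M => head_eig s M i).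
Proof. exact: coord_continuous. Qed.

Lemma block_exp_continuous : continuous block_exp.
Proof.
move=> M; have FF : Filter (nbhs M) := nbhs_filter M.
apply: cvg_mulmx.
  apply: cvg_head_diag => i.
  exact: (cvg_comp _ _ (@head_eig_continuous i M) (@cexp_continuous R _)).
apply: cvg_trunc_exp; apply: cvgB; first exact: cvg_id.
by apply: cvg_head_diag => i; exact: head_eig_continuous.
Qed.

Lemma trunc_exp_head_diag c k : trunc_exp k (head_diag s c)
  = head_diag s (fun i => exp_sum k (c i)).
Proof.
rewrite /trunc_exp -head_diag_sum; apply: eq_bigr => j _.
by rewrite head_diagX -head_diagZ; apply: eq_head_diag.
Qed.

(** Expanding (N + D)^k, only the powers of N less than the size of the matrix
    survive, and each of them is multiplied by a partial sum of the exponential of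
    the diagonal matrix D. *)
Lemma trunc_exp_cvg M : block_trig s M -> (fun k => trunc_exp k M)
  @ \oo --> block_exp M.
Proof.
move=> KM; have sN := strictly_trig_nilpart KM.
have cDN : nilpart s M * head_diag s (head_eig s M) = head_diag s (head_eig s M)
  * nilpart s M.
  by rewrite (head_diagC _ (block_trig_nilpart KM).1).
have -> : (fun k => trunc_exp k M) = (fun k => \sum_(i < n.+3)
    ((i`!%:R : C)^-1 *: nilpart s M ^+ i) *
     head_diag s (fun j => exp_sum (k - i) (head_eig s M j))).
  apply/funext => k; rewrite -[in LHS](nilpartK s M)
    addrC trunc_expD_triangle//.
  pose F i := ((i`!%:R : C)^-1 *: nilpart s M ^+ i) *
     trunc_exp (k - i) (head_diag s (head_eig s M)).
  under eq_bigr do rewrite -mulr_sumr.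
  under [RHS]eq_bigr do rewrite -trunc_exp_head_diag.
  rewrite -/(\sum_(i < k) F i) -/(\sum_(i < n.+3) F i).
  have E a b : (forall i, (a <= i)%N -> F i = 0) ->
      \sum_(i < a + b) F i = \sum_(i < a) F i.
    move=> F0; rewrite big_split_ord -[RHS]addr0; congr (_ + _).
    by apply: big1 => i _; rewrite F0// leq_addr.
  (* Both sums are extended to k + n.+3 terms: those with i >= k contain an empty
     sum, those with i >= n.+3 a power of a nilpotent matrix. *)
  rewrite -(E k n.+3); last first.
    by move=> i ki;
      rewrite /F (eqP (_ : (k - i == 0)%N))// /trunc_exp big_ord0 mulr0.
  rewrite addnC E// => i ni; rewrite /F strictly_trigX0 ?scaler0 ?mul0r//.
  by apply: leq_trans ni; rewrite -addn2 leq_addr.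
rewrite /block_exp (head_diagC _ (block_trig_trunc_exp _ (block_trig_nilpart KM)).1).
rewrite {1}/trunc_exp mulr_suml.
apply: cvg_bigsum => i _; apply: cvg_mulmx; first exact: cvg_cst.
apply: cvg_head_diag => j.
exact: (cvg_comp _ _ (@cvg_subnr i) (@exp_sum_cvg R (head_eig s M j))).
Qed.

End BlockExponential.

(** * The logarithm of a block triangular matrix *)

Section BlockLogarithm.
Variables (R : realType) (n : nat) (s : block_map n).
Local Notation C := R[i].
Local Notation m := n.+1.
Implicit Types (M N X Y : 'M[C]_m) (c : 'I_m -> C).

Definition log_poly : {poly C} := sval (cid (nilpotent_log C m)).

(** The matrix minus 1, once each block is divided by its eigenvalue: the nilpotent
    matrix to which the polynomial logarithm applies. *)
Definition unipart M := head_diag s (fun i => (head_eig s M i)^-1) * M - 1.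

Definition block_log M :=
  head_diag s (fun i => clog (head_eig s M i)) + horner_mx (unipart M) log_poly.

Lemma log_polyP : 'X %| log_poly /\ forall N, strictly_trig N ->
    horner_mx (trunc_exp n.+3 N - 1) log_poly = N /\
    trunc_exp n.+3 (horner_mx N log_poly) = 1 + N.
Proof.
rewrite /log_poly; case: cid => g [gX gP] /=; split=> // N sN.
by apply: gP; exact: strictly_trigX0.
Qed.

Lemma strictly_trig_diag0P N : block_trig s N -> (forall i, N i i = 0)
  -> strictly_trig N.
Proof.
move=> [bN _] N0 i j Nij; rewrite ltn_neqAle (bN _ _ Nij).1 andbT.
by apply: contraNneq Nij => /val_inj ->; rewrite N0.
Qed.

Lemma block_trig_unipart M : block_trig s M -> block_trig s (unipart M).
Proof.
move=> KM; apply: block_trigD; last by apply: block_trigN; exact: block_trig1.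
by apply: block_trigM => //; exact: block_trig_diag.
Qed.

Lemma strictly_trig_unipart M : block_trig s M ->
  (forall i, head_eig s M i != 0) -> strictly_trig (unipart M).
Proof.
move=> KM M0; apply: strictly_trig_diag0P => [|i];
  first exact: block_trig_unipart.
rewrite mxE (mul_diag_entry _ (block_trig_diag s _).1 KM.1)
  head_diagE eqxx mulr1n.
have -> : head_eig s M (s i) = head_eig s M i
  by rewrite /head_eig block_head_idem.
by rewrite (KM.2 i) -/(head_eig s M i) mulVf ?M0// !mxE eqxx subrr.
Qed.

Lemma strictly_trig_log N : block_trig s N -> strictly_trig N ->
  strictly_trig (horner_mx N log_poly).
Proof.
move=> KN sN; apply: strictly_trig_diag0P => [|i];
  first exact: block_trig_horner.
have /dvdpP[q ->] := log_polyP.1; rewrite rmorphM/= horner_mx_X.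
by rewrite (mul_diag_entry _ (block_trig_horner _ KN).1 KN.1)
  (strictly_trig_diag _ sN) mulr0.
Qed.

Lemma block_trig_log M : block_trig s M -> block_trig s (block_log M).
Proof.
move=> KM; apply: block_trigD; first exact: block_trig_diag.
by apply: block_trig_horner; exact: block_trig_unipart.
Qed.

Lemma head_eig_log M i : block_trig s M -> (forall i, head_eig s M i != 0) ->
  head_eig s (block_log M) i = clog (head_eig s M i).
Proof.
move=> KM M0; rewrite head_eig_diagD;
  first by rewrite /head_eig block_head_idem.
by apply: strictly_trig_log;
  [exact: block_trig_unipart|exact: strictly_trig_unipart].
Qed.

Lemma block_logK M : block_trig s M -> (forall i, head_eig s M i != 0)
  -> block_exp s (block_log M) = M.
Proof.
move=> KM M0; have sU := strictly_trig_unipart KM M0.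
rewrite block_exp_diagD; last by apply: strictly_trig_log => //;
  exact: block_trig_unipart.
rewrite (log_polyP.2 _ sU).2 addrC subrK mulrA -head_diagM.
rewrite (eq_head_diag (d := fun=> 1)) ?head_diag1 ?mul1r// => i.
by rewrite clogK ?divff.
Qed.

Lemma block_log_comm M Y : block_trig s M -> block_trig s Y -> Y * M = M * Y ->
  Y * block_log M = block_log M * Y.
Proof.
move=> KM KY YM; rewrite /block_log mulrDr mulrDl (head_diagC _ KY.1);
  congr (_ + _).
apply: comm_mx_horner; rewrite /comm_mx/= mulmxE /unipart mulrBr mulrBl.
by rewrite mulr1 mul1r mulrA -(head_diagC _ KY.1) -!mulrA YM.
Qed.

(** The nilpotent part of M is a polynomial in exp M divided by the exponential of
    the diagonal part of M, and that diagonal part commutes with all block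
    triangular matrices. So the commutation of exponentials gives that of the
    exponents, although the exponential is not injective. *)
Lemma comm_of_block_exp M Y : block_trig s M -> block_trig s Y -> Y *
  block_exp s M = block_exp s M * Y ->
  Y * M = M * Y.
Proof.
move=> KM KY YE; have sN := strictly_trig_nilpart KM.
pose E := head_diag s (fun i => (cexp (head_eig s M i))^-1).
have TE : trunc_exp n.+3 (nilpart s M) = E * block_exp s M.
  rewrite /block_exp mulrA -head_diagM (eq_head_diag (d := fun=> 1))
    ?head_diag1 ?mul1r// => i.
  by rewrite mulVf// cexp_neq0.
have YN : Y * nilpart s M = nilpart s M * Y.
  rewrite -(log_polyP.2 _ sN).1; apply: comm_mx_horner.
  rewrite /comm_mx/= mulmxE TE mulrBr mulrBl mulr1 mul1r.
  congr (_ - _); rewrite mulrA /E -(head_diagC _ KY.1) -[LHS]mulrA YE;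
    exact: mulrA.
by rewrite -(nilpartK s M) mulrDr mulrDl (head_diagC _ KY.1) YN.
Qed.

Lemma cvg_horner_mx (T : Type) (F : set_system T) {FF : Filter F}
    (f : T -> 'M[C]_m) (A : 'M[C]_m) (p : {poly C}) :
  f @ F --> A -> (fun x => horner_mx (f x) p) @ F --> horner_mx A p.
Proof.
move=> fA; elim/poly_ind: p => [|p c IH].
  by under eq_fun do rewrite rmorph0; rewrite rmorph0; exact: cvg_cst.
have E X : horner_mx X (p * 'X + c%:P) = horner_mx X p *m X + c%:M.
  by rewrite rmorphD rmorphM/= horner_mx_X horner_mx_C.
under eq_fun do rewrite E; rewrite E.
refine (@cvg_mxD _ T F FF m m (fun x => horner_mx (f x) p *m f x) (fun=> c%:M)
  _ _ _ _).
  refine (@cvg_mulmx _ T F FF m m m (fun x => horner_mx (f x) p) f _ _ IH fA).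
apply: cvg_cst.
Qed.

(** Continuity at 1 is enough: multiplication by exp (- N) brings exp N to 1. *)
Lemma block_log_cvg1 : block_log @ (1 : 'M[C]_m) --> (0 : 'M[C]_m).
Proof.
have FF : Filter (nbhs (1 : 'M[C]_m)) := nbhs_filter (1 : 'M[C]_m).
have ev1 i : head_eig s (1 : 'M[C]_m) i = 1 by rewrite /head_eig mxE eqxx.
have evc i : (fun X => head_eig s X i) @ (1 : 'M[C]_m) --> (1 : C).
  by rewrite -[X in _ --> X](ev1 i); exact: head_eig_continuous.
have -> : 0 = head_diag s (fun=> clog 1) +
    horner_mx (head_diag s (fun=> 1^-1) * 1 - 1) log_poly :> 'M[C]_m.
  rewrite clog1 invr1 head_diag1 mulr1 subrr.
  have /dvdpP[q ->] := log_polyP.1; rewrite rmorphM/= horner_mx_X mulr0 addr0.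
  by apply/matrixP => i j; rewrite head_diagE mxE mul0rn.
apply: cvgD.
  by apply: cvg_head_diag => i;
    exact: (cvg_comp _ _ (evc i) (@clog_continuous1 R)).
apply: cvg_horner_mx; apply: cvgB; last exact: cvg_cst.
apply: cvg_mulmx; last exact: cvg_id.
by apply: cvg_head_diag => i; apply: cvgV; [exact: oner_neq0|exact: evc].
Qed.

End BlockLogarithm.

(** * Bicommutants and dense orbits *)

Section Bicommutant.
Variables (R : realType) (n : nat) (s : block_map n).
Local Notation C := R[i].
Local Notation m := n.+1.
Implicit Types (M N X Y Z : 'M[C]_m) (v w : 'cV[C]_m) (S : set 'M[C]_m).

(** The bicommutant of S among block triangular matrices. Unlike the linear span of
    S, it is visibly stable under exponential and logarithm, which preserve
    commutation. *)
Definition bicomm S X := block_trig s X /\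
  forall Y, block_trig s Y -> (forall Z, S Z -> Y * Z = Z * Y) -> X * Y = Y * X.

Definition commuting_in_block_trig S :=
  (forall X, S X -> block_trig s X)
    /\ (forall X Y, S X -> S Y -> X * Y = Y * X).

Lemma sub_bicomm S X : commuting_in_block_trig S -> S X -> bicomm S X.
Proof. by move=> [SK _] SX; split=> [|Y _ YS]; [exact: SK|rewrite YS]. Qed.

(** The elements of S commute with S, so those of the bicommutant do too, and
    therefore commute with the bicommutant. *)
Lemma bicomm_comm S X Y : commuting_in_block_trig S -> bicomm S X ->
  bicomm S Y -> X * Y = Y * X.
Proof.
move=> [SK SC] [KX BX] [KY BY]; apply: BX => // Z SZ.
by apply: BY => [|W SW]; [exact: SK|exact: SC].
Qed.

Lemma bicomm0 S : bicomm S 0.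
Proof. by split=> [|Y _ _]; [exact: block_trig0|rewrite mul0r mulr0]. Qed.

Lemma bicomm1 S : bicomm S 1.
Proof. by split=> [|Y _ _]; [exact: block_trig1|rewrite mul1r mulr1]. Qed.

Lemma bicommZD S a X Y : bicomm S X -> bicomm S Y -> bicomm S (a *: X + Y).
Proof.
move=> [KX BX] [KY BY]; split=> [|Z KZ ZS]; first by apply: block_trigD => //;
  exact: block_trigZ.
by rewrite mulrDl mulrDr -scalerAl -scalerAr BX// BY.
Qed.

Lemma bicomm_log S X : bicomm S X -> bicomm S (block_log s X).
Proof.
move=> [KX BX]; split=> [|Y KY YS]; first exact: block_trig_log.
by apply/esym/block_log_comm => //; rewrite BX.
Qed.

Lemma bicomm_exp S X : bicomm S X -> bicomm S (block_exp s X).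
Proof.
move=> [KX BX]; split=> [|Y KY YS]; first exact: block_trig_exp.
by apply/esym/block_exp_comm => //; rewrite BX.
Qed.

(** A matrix that is block diagonal and lower triangular has a single nonzero entry
    in the row of a block head. *)
Lemma mulmx_head X v i : block_trig s X -> (X *m v) (s i) 0 = head_eig s X i *
  v (s i) 0.
Proof.
move=> [bX _]; rewrite mxE (bigD1 (s i))//= big1 ?addr0// => j ji.
apply/eqP; rewrite mulf_eq0; apply/orP; left; apply: contraNT ji => /bX[jsi].
rewrite block_head_idem => sj; apply/eqP/val_inj/eqP; rewrite eqn_leq jsi.
by rewrite -{1}sj block_head_le.
Qed.

Lemma mulmx_first X v : block_trig s X -> (X *m v) ord0 0 = X ord0 ord0 *
  v ord0 0.
Proof.
by move=> KX; have := mulmx_head v ord0 KX; rewrite /head_eig block_head0.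
Qed.

Definition orbit S v : set 'cV[C]_m := [set X *m v | X in S].

Lemma orbit_bicomm_linear S v : linear_set (orbit (bicomm S) v).
Proof.
split; first by exists 0; [exact: bicomm0|rewrite mul0mx].
move=> a _ _ [X BX <-] [Y BY <-]; exists (a *: X + Y); first exact: bicommZD.
by rewrite mulmxDl scalemxAl.
Qed.

(** The differences of vectors of the slice of first coordinate 1 give the slice 0. *)
Lemma linear_set_slice1 (T : set 'cV[C]_m) : linear_set T ->
  (forall w, w ord0 0 = 1 -> T w) -> forall w, T w.
Proof.
move=> [T0 TD] T1 w.
have Te : T (delta_mx ord0 0) by apply: T1; rewrite mxE !eqxx.
have -> : w = (w ord0 0 - 1) *: delta_mx ord0 0 +
     (w - (w ord0 0 - 1) *: delta_mx ord0 0) by rewrite addrC subrK.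
apply: TD => //; apply: T1; rewrite !mxE !eqxx/= mulr1.
by rewrite opprB addrC subrK.
Qed.

Lemma linear_set_slice0 (T : set 'cV[C]_m) u : linear_set T ->
  (forall w, w ord0 0 = 0 -> T w) -> T u -> u ord0 0 = 1 -> forall w, T w.
Proof.
move=> [T0 TD] Ts Tu u1 w.
have -> : w = w ord0 0 *: u + (w - w ord0 0 *: u) by rewrite addrC subrK.
by apply: TD => //; apply: Ts; rewrite !mxE u1 mulr1 subrr.
Qed.

(** The matrices X_i of the bicommutant with X_i v = e_i give theta w = sum_i w_i X_i.
    By commutativity, an element of the bicommutant that kills v kills the orbit
    of v, which is everything; hence theta is also a left inverse of X |-> X v. *)
Lemma bicomm_section S v : commuting_in_block_trig S ->
  (forall w, orbit (bicomm S) v w) ->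
  exists theta : 'cV[C]_m -> 'M[C]_m, [/\ continuous theta,
    (forall w, bicomm S (theta w) /\ theta w *m v = w) &
    (forall X, bicomm S X -> theta (X *m v) = X)].
Proof.
move=> SC cyc.
have /choice[X XP] : forall i : 'I_m, exists X, bicomm S X /\ X *m v =
  delta_mx i 0.
  by move=> i; have [X BX Xv] := cyc (delta_mx i 0); exists X.
pose theta w := \sum_i w i 0 *: X i.
have thB w : bicomm S (theta w).
  rewrite /theta; elim/big_ind: _ => [|A B BA BB|i _]; first exact: bicomm0.
    by rewrite -[A]scale1r; exact: bicommZD.
  by rewrite -[_ *: _]addr0; apply: bicommZD; [exact: (XP i).1|exact: bicomm0].
have thv w : theta w *m v = w.
  rewrite /theta mulmx_suml [RHS]matrix_sum_delta; apply: eq_bigr => i _.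
  by rewrite big_ord1 -scalemxAl (XP i).2.
exists theta; split=> //.
  move=> w; have FF : Filter (nbhs w) := nbhs_filter w.
  apply: cvg_mx => a b; under eq_fun do rewrite /theta summxE.
  rewrite /theta summxE; apply: cvg_bigsum => i _.
  under eq_fun do rewrite mxE; rewrite mxE.
  by apply: cvgM; [exact: coord_continuous|exact: cvg_cst].
move=> A BA; apply/eqP; rewrite -subr_eq0; apply/eqP.
(* theta (A v) - A kills v, hence every Y v with Y in the bicommutant. *)
have D0 w : (theta (A *m v) - A) *m w = 0.
  have [Y BY <-] := cyc w; rewrite mulmxA mulmxE.
  have BD : bicomm S (theta (A *m v) - A).
    by rewrite addrC -scaleN1r; apply: bicommZD.
  by rewrite (bicomm_comm SC BD BY) -mulmxE -mulmxA mulmxBl thv subrr mulmx0.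
apply/matrixP => i j; have /matrixP/(_ i 0) := D0 (delta_mx j 0).
by rewrite -colE !mxE.
Qed.

Definition head_vec : 'cV[C]_m := \col_i (s i == i)%:R.

Lemma head_vec_head i : head_vec (s i) 0 = 1.
Proof. by rewrite mxE block_head_idem eqxx. Qed.

Lemma head_vec0 : head_vec ord0 0 = 1.
Proof. by rewrite -(block_head0 s) head_vec_head. Qed.

Lemma block_trig_unitmx X : block_trig s X -> (forall i, head_eig s X i != 0)
  -> X \in unitmx.
Proof.
move=> [bX dX] X0; rewrite unitmxE det_trig; last first.
  apply/is_trig_mxP => i j ij; apply/eqP; apply: contraTT ij => /bX[ji _].
  by rewrite -leqNgt.
by rewrite unitfE; apply/prodf_neq0 => i _; rewrite dX; exact: X0.
Qed.

Variable H : set 'M[C]_m.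
Hypothesis HC : commuting_in_block_trig H.
Hypothesis H1 : forall X, H X -> X ord0 ord0 = 1.

Definition log_set : set 'M[C]_m :=
  [set N | [/\ block_trig s N, N ord0 ord0 = 0 & H (block_exp s N)]].

Definition dense_in_slice (a : C) (T : set 'cV[C]_m) :=
  forall w, w ord0 0 = a -> closure T w.

(** The orbit of v under the bicommutant is a linear subspace, hence closed. *)
Lemma closure_sub_orbit (S : set 'M[C]_m) v w :
  commuting_in_block_trig S -> closure (orbit S v) w -> orbit (bicomm S) v w.
Proof.
move=> SC cl; apply: linear_set_closed; first exact: orbit_bicomm_linear.
by apply: closureS cl => _ [X SX <-]; exists X => //; exact: sub_bicomm.
Qed.

(** The head vector is X v for an invertible X of the bicommutant, and X commutes
    with H, so its orbit is the image of the dense orbit of v under X. *)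
Lemma dense_orbit_head v : v ord0 0 = 1 ->
  dense_in_slice 1 (orbit H v) -> dense_in_slice 1 (orbit H head_vec).
Proof.
move=> v1 dv.
have cyc : forall w, orbit (bicomm H) v w.
  apply: linear_set_slice1; first exact: orbit_bicomm_linear.
  by move=> w w1; apply: closure_sub_orbit => //; exact: dv.
have [X BX Xv] := cyc head_vec; have KX := BX.1.
have X0 i : head_eig s X i != 0.
  have := mulmx_head v i KX; rewrite Xv head_vec_head => /esym/eqP.
  by apply: contraTneq => ->; rewrite mul0r eq_sym oner_eq0.
have uX := block_trig_unitmx KX X0.
have X1 : X ord0 ord0 = 1.
  by have := mulmx_first v KX; rewrite Xv head_vec0 v1 mulr1.
move=> w w1; pose y := invmx X *m w.
have Xy : X *m y = w by rewrite mulmxA mulmxV// mul1mx.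
have y1 : y ord0 0 = 1.
  by have := mulmx_first y KX; rewrite Xy X1 w1 mul1r.
have FF : Filter (nbhs y) := nbhs_filter y.
apply: (@closure_map _ _ _ _ (fun z : 'cV[C]_m => X *m z) _ _ (dv _ y1)).
  rewrite -Xy; apply: cvg_mulmx; [exact: cvg_cst|exact: cvg_id].
apply: (@nearW _ _ _ FF) => _ [h Hh <-]; exists h => //.
rewrite -Xv !mulmxA !mulmxE; congr (_ *m _).
by rewrite (bicomm_comm HC BX (sub_bicomm HC Hh)).
Qed.

(** Let N in the bicommutant of H be such that N u = w. The map
    y |-> (N + log (exp (- N) theta y)) u is continuous at exp(N) u, where its value
    is w, and sends the points of the orbit H u near exp(N) u to points of L u. *)
Lemma dense_log_set :
  dense_in_slice 1 (orbit H head_vec)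
    -> dense_in_slice 0 (orbit log_set head_vec).
Proof.
move=> dH.
have cyc : forall w, orbit (bicomm H) head_vec w.
  apply: linear_set_slice1; first exact: orbit_bicomm_linear.
  by move=> w w1; apply: closure_sub_orbit => //; exact: dH.
have [theta [thc thB thK]] := bicomm_section HC cyc.
move=> w w0; have [BN Nw] := thB w; set N := theta w in BN Nw *.
have KN := BN.1.
have N0 : N ord0 ord0 = 0.
  by have := mulmx_first head_vec KN; rewrite Nw w0 head_vec0 mulr1.
have NN : N * - N = - N * N by rewrite mulrN mulNr.
have eNN : block_exp s N * block_exp s (- N) = 1.
  by rewrite -block_expD ?subrr ?block_exp0//; exact: block_trigN.
have eNN' : block_exp s (- N) * block_exp s N = 1.
  by rewrite -block_expD// ?addNr ?block_exp0//; exact: block_trigN.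
pose w' := block_exp s N *m head_vec.
have ev0 X : head_eig s X ord0 = X ord0 ord0 by rewrite /head_eig block_head0.
have eN1 : block_exp s N ord0 ord0 = 1
  by rewrite -ev0 head_eig_exp// ev0 N0 cexp0.
have w'1 : w' ord0 0 = 1.
  by rewrite (mulmx_first _ (block_trig_exp KN)) eN1 head_vec0 mul1r.
have FF : Filter (nbhs w') := nbhs_filter w'.
(* For X in H, theta (X u) = X, so that G (X u) = exp (- N) X. *)
pose G y := block_exp s (- N) *m theta y.
have Gc : G @ w' --> (1 : 'M[C]_m).
  have -> : 1 = block_exp s (- N) *m theta w'.
    by rewrite thK; [rewrite mulmxE eNN'|exact: bicomm_exp].
  by apply: cvg_mulmx; [exact: cvg_cst|exact: thc].
apply: (@closure_map _ _ _ _ (fun y => (N + block_log s (G y)) *m head_vec) _ _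
  (dH _ w'1)).
  have E : (N + 0) *m head_vec = w by rewrite addr0.
  rewrite -[X in _ --> X]E.
  apply: cvg_mulmx; last exact: cvg_cst.
  apply: cvg_mxD; first exact: cvg_cst.
  exact: (cvg_comp _ _ Gc (@block_log_cvg1 R n s)).
have Gn0 : \forall y \near w', forall i, head_eig s (G y) i != 0.
  apply: (@filter_forall _ _ (fun i y => head_eig s (G y) i != 0) _ FF) => i.
  have ec : (fun y => head_eig s (G y) i) @ w' --> (1 : C).
    have -> : 1 = (1 : 'M[C]_m) (s i) (s i) by rewrite mxE eqxx.
    exact: (@cvg_coord _ _ _ FF _ _ _ _ (s i) (s i) Gc).
  exact: (@cvgr_neq0 _ _ _ _ FF _ _ ec (oner_neq0 _)).
apply: filterS Gn0 => y Gy0 [X HX yE]; rewrite -yE in Gy0 *.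
have BX := sub_bicomm HC HX.
have GE : G (X *m head_vec) = block_exp s (- N) * X by rewrite /G thK.
rewrite GE in Gy0 *.
have KX := BX.1.
have KG : block_trig s (block_exp s (- N) * X)
  by apply: block_trigM => //; exact/block_trig_exp/block_trigN.
exists (N + block_log s (block_exp s (- N) * X)) => //; split.
- by apply: block_trigD => //; exact: block_trig_log.
- rewrite mxE N0 add0r -ev0 head_eig_log// head_eigM//;
  last exact/block_trig_exp/block_trigN.
  rewrite head_eig_exp; last exact: block_trigN.
  by rewrite !ev0 mxE N0 oppr0 cexp0 (H1 HX) mulr1 clog1.
rewrite block_expD//; first last.
- apply: block_log_comm => //.
  rewrite -[RHS]mulrA (bicomm_comm HC BX BN) [LHS]mulrA [RHS]mulrA;
    congr (_ * _).
  by apply: block_exp_comm => //; exact: block_trigN.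
- exact: block_trig_log.
by rewrite block_logK// mulrA eNN mul1r.
Qed.

End Bicommutant.

Section LogsetDense.
Variables (R : realType) (n : nat) (s : block_map n).
Local Notation C := R[i].
Local Notation m := n.+1.
Implicit Types (M N X Y Z : 'M[C]_m) (v w : 'cV[C]_m) (S : set 'M[C]_m).
Variable H : set 'M[C]_m.
Hypothesis HC : commuting_in_block_trig s H.

(** The exponentials belong to H, so they commute; apply twice the fact that what
    commutes with an exponential commutes with the exponent. *)
Lemma log_set_commuting : commuting_in_block_trig s (log_set s H).
Proof.
split=> [X [] //|X Y [KX _ HX] [KY _ HY]].
apply: (comm_of_block_exp KY KX); apply/esym.
by apply: (comm_of_block_exp KX (block_trig_exp KY)); exact: HC.2.
Qed.

Lemma log_setD : (forall X Y, H X -> H Y -> H (X * Y)) ->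
  forall X Y, log_set s H X -> log_set s H Y -> log_set s H (X + Y).
Proof.
move=> HM X Y lX lY; have XY := log_set_commuting.2 _ _ lX lY.
case: lX lY => [KX X0 HX] [KY Y0 HY]; split; first exact: block_trigD.
  by rewrite mxE X0 Y0 addr0.
by rewrite block_expD//; exact: HM.
Qed.

(** If all the head coordinates of w are nonzero then w = X u for an invertible X of
    the bicommutant of L, and the continuous map y |-> exp (theta y) u sends L u
    into H u and log(X) u to w. Other vectors are limits of such ones. *)
Lemma dense_orbit_of_log_set :
  dense_in_slice 0 (orbit (log_set s H) (head_vec R s)) ->
  dense_in_slice 1 (orbit H (head_vec R s)).
Proof.
move=> dL; have LC := log_set_commuting.
have cyc : forall w, orbit (bicomm s (log_set s H)) (head_vec R s) w.
  apply: (linear_set_slice0 (u := head_vec R s)).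
  - exact: orbit_bicomm_linear.
  - by move=> w w0; apply: closure_sub_orbit => //; exact: dL.
  - by exists 1; [exact: bicomm1|rewrite mul1mx].
  - exact: head_vec0.
have [theta [thc thB thK]] := bicomm_section LC cyc.
have ev0 X : head_eig s X ord0 = X ord0 ord0 by rewrite /head_eig block_head0.
have gen w : w ord0 0 = 1 -> (forall i, w (s i) 0 != 0) ->
    closure (orbit H (head_vec R s)) w.
  move=> w1 wn0; have [BX Xw] := thB w; set X := theta w in BX Xw *.
  have KX := BX.1.
  have evX i : head_eig s X i = w (s i) 0.
    by rewrite -Xw mulmx_head// head_vec_head mulr1.
  have X0 i : head_eig s X i != 0 by rewrite evX.
  have L0 : block_log s X ord0 ord0 = 0.
    by rewrite -ev0 head_eig_log// evX block_head0 w1 clog1.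
  have BL := bicomm_log BX.
  pose y := block_log s X *m head_vec R s.
  have y0 : y ord0 0 = 0
    by rewrite (mulmx_first _ (block_trig_log KX)) L0 mul0r.
  have FF : Filter (nbhs y) := nbhs_filter y.
  apply: (@closure_map _ _ _ _ (fun z => block_exp s (theta z) *m head_vec R s)
    _ _
    (dL _ y0)).
    have E : block_exp s (theta y) *m head_vec R s = w
      by rewrite /y thK// block_logK.
    rewrite -[X in _ --> X]E; apply: cvg_mulmx; last exact: cvg_cst.
    exact: (cvg_comp _ _ (thc y) (@block_exp_continuous R n s _)).
  apply: (@nearW _ _ _ FF) => _ [N LN <-].
  by rewrite thK; [exists (block_exp s N) => //; case: LN|exact: sub_bicomm].
move=> w w1; apply: closure_idem.
have FF : Filter (nbhs (0 : C)) := nbhs_filter (0 : C).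
(* Replace the zero coordinates of w by a small t; the first one is 1. *)
pose p (t : C) : 'cV[C]_m := \col_i (if w i 0 == 0 then t else w i 0).
have cl0 : closure [set t : C | t != 0] 0.
  move=> B /nbhs_ballP[e /= e0 eB]; exists (e / 2); split.
    by rewrite /= mulf_neq0 ?invr_neq0 ?pnatr_eq0// gt_eqF.
  apply: eB; rewrite /ball/= sub0r normrN gtr0_norm ?divr_gt0//.
  by rewrite ltr_pdivrMr// mulr_natr mulr2n ltrDl.
apply: (@closure_map _ _ _ _ p _ _ cl0).
  apply: cvg_mx => i j; rewrite ord1; under eq_fun do rewrite mxE.
  by case: eqP => [->|_]; [exact: cvg_id|exact: cvg_cst].
apply: (@nearW _ _ _ FF) => t t0; apply: gen.
  by rewrite mxE w1 oner_eq0.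
by move=> i; rewrite mxE; case: ifPn.
Qed.

End LogsetDense.

(** * Blocks of given sizes *)

Section BlockMapOfSizes.
Variables (R : realType) (n r : nat) (eta : 'I_r -> nat).
Hypothesis eta_gt0 : forall k, (0 < eta k)%N.
Hypothesis eta_sum : (\sum_k eta k)%N = (1 + n)%N.
Local Notation C := R[i].
Local Notation m := n.+1.

(** The casts along [eta_sum] are confined to this function and to [pos]. *)
Definition blk (i : 'I_m) : 'I_r := tagnat.sig1 (cast_ord (esym eta_sum) i).

Definition pos k (j : 'I_(eta k)) : 'I_m :=
  cast_ord eta_sum (@tagnat.Rank r eta _ j).

Lemma blk_pos k (j : 'I_(eta k)) : blk (pos j) = k.
Proof. by rewrite /blk /pos cast_ordK tagnat.Rank1K. Qed.

Lemma pos_val k (j : 'I_(eta k)) :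
  pos j = (\sum_(l < r | (l < k)%N) eta l + j)%N :> nat.
Proof. exact: tagnat.RankEsum. Qed.

Lemma posP (i : 'I_m) : exists j : 'I_(eta (blk i)), i = pos j.
Proof.
exists (tagnat.sig2 (cast_ord (esym eta_sum) i)).
by rewrite /pos tagnat.sig2K cast_ordKV.
Qed.

Definition head_of k : 'I_m := pos (Ordinal (eta_gt0 k)).

Lemma head_of_le i : (head_of (blk i) <= i)%N.
Proof. by have [j {2}->] := posP i; rewrite !pos_val addn0 leq_addr. Qed.

Lemma head_of_idem i : head_of (blk (head_of (blk i))) = head_of (blk i).
Proof. by rewrite blk_pos. Qed.

Definition sizes_block_map : block_map n :=
  @BlockMap n (fun i => head_of (blk i)) head_of_le head_of_idem.
Local Notation s := sizes_block_map.

Lemma block_head_pos k (j : 'I_(eta k)) : s (pos j) = head_of k.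
Proof. by rewrite /= blk_pos. Qed.

Lemma castmx_mxdiag_pos (B : forall k, 'M[C]_(eta k)) k (j j' : 'I_(eta k)) :
  (castmx (eta_sum, eta_sum) (\mxdiag_k B k) : 'M[C]_m) (pos j) (pos j')
    = B k j j'.
Proof.
rewrite castmxE /pos !cast_ordK.
have -> : (\mxdiag_k B k) (@tagnat.Rank r eta _ j) (@tagnat.Rank r eta _ j') =
   submxblock (\mxdiag_k B k) k k j j' by rewrite !mxE.
by rewrite /mxdiag mxblockK eqxx conform_mx_id.
Qed.

Lemma castmx_mxdiag_pos0 (B : forall k, 'M[C]_(eta k)) k k'
    (j : 'I_(eta k)) (j' : 'I_(eta k')) : k != k' ->
  (castmx (eta_sum, eta_sum) (\mxdiag_k B k) : 'M[C]_m) (pos j) (pos j') = 0.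
Proof.
move=> kk'; rewrite castmxE /pos !cast_ordK.
have -> : (\mxdiag_k B k) (@tagnat.Rank r eta _ j) (@tagnat.Rank r eta _ j') =
   submxblock (\mxdiag_k B k) k k' j j' by rewrite !mxE.
by rewrite /mxdiag mxblockK (negPf kk') mxE.
Qed.

Lemma KKP (M : 'M[C]_m) : KK eta_sum M <-> block_trig s M.
Proof.
split=> [[B [TB ->]]|[bM dM]].
  split=> [i i'|i]; last first.
    have [j ->] := posP i; rewrite block_head_pos !castmx_mxdiag_pos.
    exact: (TB _).2.
  have [j ->] := posP i; have [j' ->] := posP i'.
  have [e|/castmx_mxdiag_pos0 ->] := eqVneq (blk i) (blk i'); last
    by rewrite eqxx.
  move: (blk i) (blk i') e j j' => k k' <-{k'} j j'.
  rewrite castmx_mxdiag_pos !block_head_pos !pos_val leq_add2l => Bjj';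
    split=> //.
  rewrite leqNgt; apply: contraNN Bjj' => jj'.
  by have [/is_trig_mxP -> //] := TB k.
exists (fun k => \matrix_(j, j') M (pos j) (pos j')); split.
  move=> k; split=> [|j j'].
    apply/is_trig_mxP => j j' jj'; rewrite mxE; apply/eqP.
    apply: contraTT jj' => /bM[]; rewrite !pos_val leq_add2l => j'j _.
    by rewrite -leqNgt.
  by rewrite !mxE dM [RHS]dM !block_head_pos.
apply/matrixP => i i'; have [j ->] := posP i; have [j' ->] := posP i'.
have [e|kk'] := eqVneq (blk i) (blk i'); last first.
  rewrite (castmx_mxdiag_pos0 _ _ _ kk'); apply/eqP;
    apply: contraNT kk' => /bM[_].
  by rewrite !block_head_pos => /(congr1 blk); rewrite !blk_pos => ->.
move: (blk i) (blk i') e j j' => k k' <-{k'} j j'.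
by rewrite castmx_mxdiag_pos mxE.
Qed.

Lemma u0E : u0 R eta_sum = head_vec R s.
Proof.
apply/matrixP => i j; rewrite ord1 /u0 castmxE !mxE; congr (_%:R).
have -> : (s i == i) = (head_of (blk i) == i :> nat) by [].
rewrite pos_val; have := tagnat.rect (cast_ord (esym eta_sum) i).
move=> /= ->; rewrite -/(blk i).
by rewrite eqn_add2l eq_sym.
Qed.

End BlockMapOfSizes.

(** * Affine maps as matrices *)

(** Conjugation by P is continuous and commutes with the partial sums. *)
Lemma expmx_conj (R : realType) n (s : block_map n) (P N : 'M[R[i]]_n.+1) :
  P \in unitmx -> block_trig s N ->
  expmx (P *m N *m invmx P) = P *m block_exp s N *m invmx P.
Proof.
move=> uP KN; apply: cvg_lim; first exact: norm_hausdorff.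
have E k : (P *m N *m invmx P) ^+ k = P *m N ^+ k *m invmx P.
  elim: k => [|k IH]; first by rewrite !expr0 mulmx1 mulmxV.
  by rewrite !exprS IH -!mulmxE !mulmxA mulmxKV.
have -> : series (fun k => (k`!%:R)^-1 *: (P *m N *m invmx P) ^+ k) =
    (fun k => P *m trunc_exp k N *m invmx P).
  apply/funext => k;
    rewrite /series/= big_mkord /trunc_exp mulmx_sumr mulmx_suml.
  by apply: eq_bigr => i _; rewrite E -scalemxAr -scalemxAl.
apply: cvg_mulmx; last exact: cvg_cst.
by apply: cvg_mulmx; [exact: cvg_cst|exact: trunc_exp_cvg].
Qed.

Section AffineLinear.
Variables (R : realType) (n : nat).
Local Notation C := R[i].
Implicit Types (f g : affmap R n) (x y : 'cV[C]_n).

(** The affine slice of first coordinate a: maps of C^n act on the slice 1 through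
    Phi, and Psi sends the slice 1 into the slice 0. *)
Definition hat (a : C) x : 'cV[C]_(1 + n) := col_mx a%:M x.

Lemma hat0 a x : hat a x ord0 0 = a.
Proof.
have -> : ord0 = lshift n ord0 :> 'I_(1 + n) by apply: val_inj.
by rewrite col_mxEu mxE eqxx.
Qed.

Lemma Phi_hat f x : Phi f *m hat 1 x = hat 1 (aff_app f x).
Proof.
by rewrite mul_block_col mul1mx mul0mx addr0 mulmx1 addrC.
Qed.

Lemma Psi_hat f x : Psi f *m hat 1 x = hat 0 (aff_app f x).
Proof.
by rewrite mul_block_col !mul0mx addr0 mulmx1 addrC /hat raddf0.
Qed.

Lemma Phi_comp f g : Phi (aff_comp f g) = Phi f *m Phi g.
Proof.
rewrite /Phi mulmx_block !mulmx0 !mul0mx !mul1mx !mulmx1 !addr0 !add0r.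
by rewrite [f.2 + _]addrC.
Qed.

Lemma Phi_id : Phi (@aff_id R n) = 1%:M.
Proof. by rewrite /Phi -scalar_mx_block. Qed.

Lemma Phi_GA P : [set Phi f | f in @GA R n] P ->
  P \in unitmx /\ exists f g, P = Phi f /\ invmx P = Phi g.
Proof.
move=> [f [g [fg gf]] <-].
have PQ : Phi f *m Phi g = 1%:M by rewrite -Phi_comp fg Phi_id.
have [uP uQ] := mulmx1_unit PQ; split=> //; exists f, g; split=> //.
by rewrite -[LHS]mulmx1 -PQ mulmxA mulVmx// mul1mx.
Qed.

Lemma dsubmx_hat a x : dsubmx (hat a x) = x.
Proof. exact: col_mxKd. Qed.

Lemma hatK (w : 'cV[C]_(1 + n)) : hat (w ord0 0) (dsubmx w) = w.
Proof.
rewrite -[RHS]vsubmxK; congr col_mx; apply/matrixP => i j.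
by rewrite !ord1 !mxE; congr (w _ _); apply: val_inj.
Qed.

Lemma hat_cvg a x : (fun y => hat a y) @ x --> hat a x.
Proof.
have FF : Filter (nbhs x) := nbhs_filter x.
apply: cvg_mx => i j; rewrite /hat; under eq_fun do rewrite mxE; rewrite mxE.
by case: (fintype.split i) => k; [exact: cvg_cst|exact: coord_continuous].
Qed.

Lemma dsubmx_cvg (T : Type) (F : set_system T) {FF : Filter F}
    (h : T -> 'cV[C]_(1 + n)) (w : 'cV[C]_(1 + n)) :
  h @ F --> w -> (fun t => dsubmx (h t)) @ F --> dsubmx w.
Proof.
move=> hw; apply: cvg_mx => i j; under eq_fun do rewrite mxE; rewrite mxE.
exact: cvg_coord.
Qed.

Lemma Psi_range (M : 'M[C]_(1 + n)) : (forall j, M ord0 j = 0) ->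
  M = Psi (drsubmx M, dlsubmx M).
Proof.
move=> M0; rewrite -[LHS]submxK /Psi /=.
have i0 (i : 'I_1) : lshift n i = ord0 by apply: val_inj; rewrite /= ord1.
by congr block_mx; apply/matrixP => i j; rewrite !mxE ?i0 M0.
Qed.

Lemma Phi00 f : Phi f ord0 ord0 = 1.
Proof.
have -> : ord0 = lshift n ord0 :> 'I_(1 + n) by apply: val_inj.
by rewrite block_mxEul mxE eqxx.
Qed.

Lemma Psi_row0 f j : Psi f ord0 j = 0.
Proof.
have -> : ord0 = lshift n ord0 :> 'I_(1 + n) by apply: val_inj.
by rewrite /Psi /block_mx col_mxEu row_mx0 mxE.
Qed.

End AffineLinear.

Lemma dense_closureP (X : topologicalType) (S : set X) :
  dense S <-> forall x, closure S x.
Proof.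
split=> [dS x B|cS O [x Ox] oO].
  rewrite nbhsE; case=> O [oO Ox] OB.
  have [y [Oy Sy]] := dS O (ex_intro _ x Ox) oO.
  by exists y; split=> //; exact: OB.
have [y [Sy Oy]] := cS x O (open_nbhs_nbhs (conj oO Ox)).
by exists y.
Qed.

(** * Conjugation to block triangular form *)

Section Correspondence.
Variables (R : realType) (n : nat) (s : block_map n).
Local Notation C := R[i].
Implicit Types (f g : affmap R n) (x y w : 'cV[C]_n).
Variables (G : set (affmap R n)) (P : 'M[C]_(1 + n)).
Hypothesis G_abelian : abelian_subsemigroup G.
Hypothesis P_GA : [set Phi f | f in @GA R n] P.
Hypothesis G_trig : forall f, G f -> block_trig s (invmx P *m Phi f *m P).

Definition conjG : set 'M[C]_n.+1 := [set invmx P *m Phi f *m P | f in G].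

Let uP : P \in unitmx. Proof. by have [] := Phi_GA P_GA. Qed.

Lemma conj_mul (A B : 'M[C]_(1 + n)) :
  (invmx P *m A *m P) *m (invmx P *m B *m P) = invmx P *m (A *m B) *m P.
Proof. by rewrite !mulmxA mulmxK. Qed.

Lemma conjGM X Y : conjG X -> conjG Y -> conjG (X * Y).
Proof.
move=> [f Gf <-] [g Gg <-]; exists (aff_comp f g); first exact: G_abelian.1.
by rewrite -mulmxE conj_mul Phi_comp.
Qed.

Lemma conjG_commuting : commuting_in_block_trig s conjG.
Proof.
split=> [_ [f Gf <-]|_ _ [f Gf <-] [g Gg <-]]; first exact: G_trig.
by rewrite -!mulmxE !conj_mul -!Phi_comp (G_abelian.2 f g).
Qed.

Lemma conj_hat a x : (invmx P *m hat a x) ord0 0 = a.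
Proof.
have [_ [_ [g [_ ->]]]] := Phi_GA P_GA.
rewrite /Phi /hat mul_block_col mul0mx mul1mx addr0; exact: hat0.
Qed.

Lemma mulP_row0 (w : 'cV[C]_(1 + n)) : (P *m w) ord0 0 = w ord0 0.
Proof.
have [_ [f [_ [-> _]]]] := Phi_GA P_GA.
by rewrite -{1}[w]hatK /Phi /hat mul_block_col mul0mx mul1mx addr0; exact: hat0.
Qed.

Lemma conjG00 X : conjG X -> X ord0 ord0 = 1.
Proof.
have [_ [p [q [Pp Pq]]]] := Phi_GA P_GA.
by move=> [f _ <-]; rewrite Pq Pp -!Phi_comp Phi00.
Qed.

(** The slice is homeomorphic to C^n: P preserves first coordinates, so y |-> P^-1
    (a, y) has the continuous inverse that forgets the first coordinate of P w. *)
Lemma dense_in_sliceP a (S : set 'cV[C]_n) :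
  dense S <-> dense_in_slice a [set invmx P *m hat a y | y in S].
Proof.
rewrite dense_closureP; split=> [cS w wa|cS x].
  have -> : w = invmx P *m hat a (dsubmx (P *m w)).
    by rewrite -wa -mulP_row0 hatK mulmxA mulVmx// mul1mx.
  set x := dsubmx _; have FF : Filter (nbhs x) := nbhs_filter x.
  apply: (@closure_map _ _ _ _ (fun y => invmx P *m hat a y) _ _ (cS x)).
    by apply: cvg_mulmx; [exact: cvg_cst|exact: hat_cvg].
  by apply: (@nearW _ _ _ FF) => y Sy; exists y.
set w := invmx P *m hat a x; have FF : Filter (nbhs w) := nbhs_filter w.
apply: (@closure_map _ _ _ _ (fun z : 'cV[C]_(1 + n) => dsubmx (P *m z)) _ _
  (cS w (conj_hat a x))).
  have -> : x = dsubmx (P *m w) by rewrite mulmxA mulmxV// mul1mx dsubmx_hat.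
  by apply: dsubmx_cvg; apply: cvg_mulmx; [exact: cvg_cst|exact: cvg_id].
apply: (@nearW _ _ _ FF) => _ [y Sy <-].
by rewrite mulmxA mulmxV// mul1mx dsubmx_hat.
Qed.

Lemma orbit_conjG x : orbit conjG (invmx P *m hat 1 x) =
  [set invmx P *m hat 1 y | y in aff_orbit G x].
Proof.
have E f : invmx P *m Phi f *m P *m (invmx P *m hat 1 x) =
    invmx P *m hat 1 (aff_app f x).
  by rewrite -Phi_hat !mulmxA mulmxK.
apply/seteqP; split=> [_ [_ [f Gf <-] <-]|_ [_ [f Gf <-] <-]].
  by exists (aff_app f x); [exists f|rewrite E].
by exists (invmx P *m Phi f *m P); [exists f|rewrite E].
Qed.

Lemma conjG_block_exp N : block_trig s N ->
  conjG (block_exp s N) <-> [set Phi f | f in G] (expmx (P *m N *m invmx P)).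
Proof.
move=> KN; rewrite (expmx_conj uP KN); split=> [[f Gf fE]|[f Gf fE]];
  exists f => //.
  by rewrite -fE !mulmxA mulmxV// mul1mx -!mulmxA mulmxV// mulmx1.
by rewrite fE !mulmxA mulVmx// mul1mx -!mulmxA mulVmx// mulmx1.
Qed.

(** The image of Psi is stable under products with the image of Phi on both sides. *)
Lemma conj_Psi f : exists g, invmx P *m Psi f *m P = Psi g.
Proof.
have [_ [p [q [Pp ->]]]] := Phi_GA P_GA; rewrite Pp.
exists (q.1 *m f.1 *m p.1, q.1 *m f.1 *m p.2 + q.1 *m f.2).
rewrite /Phi /Psi !mulmx_block !(mulmx0, mul0mx, mul1mx, mulmx1, addr0,
  add0r)/=.
by rewrite [_ + q.1 *m f.2]addrC.
Qed.

(** P has the same first row as the identity, so the first row of P N P^-1 is that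
    of N P^-1, and the first row of N is 0. *)
Lemma conj_row0 N : block_trig s N -> N ord0 ord0 = 0 ->
  exists f, P *m N *m invmx P = Psi f.
Proof.
move=> KN N0; eexists; apply: Psi_range => j.
have /matrixP/(_ ord0 0) := colE j (P *m N *m invmx P); rewrite mxE => ->.
by rewrite -!mulmxA mulP_row0 (mulmx_first _ KN) N0 mul0r.
Qed.

Lemma log_set_conjG f : log_set s conjG (invmx P *m Psi f *m P) <->
  block_trig s (invmx P *m Psi f *m P) /\ [set Phi f | f in G] (expmx (Psi f)).
Proof.
have PE : P *m (invmx P *m Psi f *m P) *m invmx P = Psi f.
  by rewrite !mulmxA mulmxV// mul1mx -mulmxA mulmxV// mulmx1.
split=> [[KN _ HN]|[KN GN]]; split=> //.
- by have := (conjG_block_exp KN).1 HN; rewrite PE.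
- by have [g ->] := conj_Psi f; exact: Psi_row0.
- by apply/(conjG_block_exp KN); rewrite PE.
Qed.

End Correspondence.

Section Exponents.
Variables (R : realType) (n r : nat) (eta : 'I_r -> nat).
Hypothesis eta_gt0 : forall k, (0 < eta k)%N.
Variable eta_sum : (\sum_k eta k)%N = (1 + n)%N.
Local Notation C := R[i].
Local Notation s := (sizes_block_map eta_gt0 eta_sum).
Variables (G : set (affmap R n)) (P : 'M[C]_(1 + n)).
Hypothesis G_abelian : abelian_subsemigroup G.
Hypothesis P_GA : [set Phi f | f in @GA R n] P.
Hypothesis G_trig : forall f, G f -> block_trig s (invmx P *m Phi f *m P).
Local Notation w0 := (w0 eta_sum P).
Local Notation qq := (qq eta_sum P G).

Let uP : P \in unitmx. Proof. by have [] := Phi_GA P_GA. Qed.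

Lemma qqE f : qq f <-> log_set s (conjG G P) (invmx P *m Psi f *m P).
Proof.
rewrite log_set_conjG//; split=> [[[GN [K KK_K KE]] _]|[KN GN]].
  split=> //; rewrite -KE !mulmxA mulVmx// mul1mx -mulmxA mulVmx// mulmx1.
  by apply/KKP.
split; last by exists f.
split=> //; exists (invmx P *m Psi f *m P); first exact/KKP.
by rewrite !mulmxA mulmxV// mul1mx -mulmxA mulmxV// mulmx1.
Qed.

Lemma head_vecE : head_vec R s = invmx P *m hat 1 w0.
Proof.
have /(congr1 (mulmx (invmx P))) := w0P eta_sum P_GA.
by rewrite mulmxA mulVmx// mul1mx -u0E.
Qed.

(** The conjugation by P sends the head vector to (1, w0), and Psi f sends (1, w0) to
    (0, f w0). *)
Lemma orbit_log_set : orbit (log_set s (conjG G P)) (head_vec R s) =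
  [set invmx P *m hat 0 y | y in aff_orbit qq w0].
Proof.
have E f : invmx P *m Psi f *m P *m head_vec R s =
    invmx P *m hat 0 (aff_app f w0).
  by rewrite head_vecE -Psi_hat !mulmxA mulmxK.
apply/seteqP; split=> [_ [N LN <-]|_ [_ [f qf <-] <-]]; last first.
  by exists (invmx P *m Psi f *m P); [exact/qqE|rewrite E].
have [f Nf] : exists f, P *m N *m invmx P = Psi f.
  by case: LN => KN N0 _; exact: (conj_row0 P_GA KN N0).
have NE : N = invmx P *m Psi f *m P.
  by rewrite -Nf !mulmxA mulVmx// mul1mx -mulmxA mulVmx// mulmx1.
by exists (aff_app f w0); [exists f => //; apply/qqE;
  rewrite -NE|rewrite -E -NE].
Qed.

(** Since L is commutative, exp (X + Y) = exp X * exp Y for X and Y in L, and H is a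
    semigroup. *)
Lemma qq_additive : additive_subsemigroup (aff_orbit qq w0).
Proof.
move=> _ _ [f /qqE qf <-] [g /qqE qg <-].
exists (f.1 + g.1, f.2 + g.2); last first.
  by rewrite /aff_app mulmxDl addrACA.
apply/qqE.
have -> : Psi (f.1 + g.1, f.2 + g.2) = Psi f + Psi g.
  by rewrite /Psi add_block_mx !addr0.
rewrite mulmxDr mulmxDl; apply: log_setD => //; last exact: conjGM.
exact: conjG_commuting.
Qed.

End Exponents.

Theorem theorem1p1 (R : realType) (n : nat) (n_ge1 : (1 <= n)%N)
    (G : set (affmap R n)) (G_abelian : abelian_subsemigroup G)
    (r : nat) (r_le : (r <= n + 1)%N)
    (eta : 'I_r -> nat) (eta_gt0 : forall k, (0 < eta k)%N)
    (eta_sum : (\sum_k eta k)%N = (1 + n)%N)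
    (P : 'M[R[i]]_(1 + n)) (P_GA : [set Phi f | f in @GA R n] P)
    (G_normal_form :
      [set invmx P *m M *m P | M in [set Phi f | f in G]] `<=`
      KK eta_sum `&` range (@Phi R n)) :
  [<-> hypercyclic G;
       dense (aff_orbit G (w0 eta_sum P));
       additive_subsemigroup (aff_orbit (qq eta_sum P G) (w0 eta_sum P)) /\
       dense (aff_orbit (qq eta_sum P G) (w0 eta_sum P))].
Proof.
pose s := sizes_block_map eta_gt0 eta_sum.
have G_trig f : G f -> block_trig s (invmx P *m Phi f *m P).
  move=> Gf; apply/KKP.
  by have [] := G_normal_form (invmx P *m Phi f *m P);
    [exists (Phi f) => //; exists f|].
have HC := conjG_commuting G_abelian P_GA G_trig.
have H1 := conjG00 (G := G) P_GA.
have dense_w0 : dense (aff_orbit G (w0 eta_sum P)) <->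
    dense_in_slice 1 (orbit (conjG G P) (head_vec R s)).
  by rewrite (head_vecE eta_gt0 eta_sum P_GA) (orbit_conjG _ P_GA)
    -(dense_in_sliceP P_GA).
have dense_q : dense (aff_orbit (qq eta_sum P G) (w0 eta_sum P)) <->
    dense_in_slice 0 (orbit (log_set s (conjG G P)) (head_vec R s)).
  by rewrite (orbit_log_set eta_gt0 eta_sum G P_GA) -(dense_in_sliceP P_GA).
tfae.
- move=> [v Gv]; apply/dense_w0.
  apply: (dense_orbit_head HC (v := invmx P *m hat 1 v)).
    exact: conj_hat.
  rewrite (orbit_conjG _ P_GA); apply/(dense_in_sliceP P_GA).
  by apply/dense_closureP => x; rewrite Gv.
- move=> /dense_w0 dH; split.
    exact: (qq_additive G_abelian P_GA G_trig).
  by apply/dense_q; exact: dense_log_set.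
- move=> [_ /dense_q dL]; exists (w0 eta_sum P).
  have /dense_closureP cl : dense (aff_orbit G (w0 eta_sum P)).
    by apply/dense_w0; exact: dense_orbit_of_log_set.
  by apply/seteqP; split.
Qed.
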